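(* Assume that for each $\beta\in\mathfrak a$ the function $\mu_{\mathfrak p}^\beta:M\to\mathbb R$ has a unique local maximum. Let $\nu\in\mathscr W(M,\mathrm A)$ and assume that $\mathrm A_\nu=\{e\}$. Then $\mathfrak F_{\mathfrak a}(\mathrm A\cdot\nu)$ coincides with the interior $\mathrm{int}(P)$ in $\mathfrak a$ of $P=\mu_{\mathfrak a}(M)$.
   Context: Setting. $(Z,J,\omega)$ is a compact connected Kähler manifold, $\mathrm U$ is a compact connected Lie group with Lie algebra $\mathfrak u$ and complexification $\mathrm U^{\mathbb C}$, with Cartan decomposition $\mathrm U^{\mathbb C}=\mathrm U\exp(i\mathfrak u)$. $\mathrm U^{\mathbb C}$ acts holomorphically on $Z$, and $\mathrm U$ preserves $\omega$ and acts in a Hamiltonian fashion with $\mathrm U$-equivariant momentum mapping $\mu:Z\to\mathfrak u^*\cong\mathfrak u$ (identification via an $\mathrm{Ad}(\mathrm U)$-invariant scalar product). $B$ is a nondegenerate $\mathrm{Ad}(\mathrm U^{\mathbb C})$-invariant symmetric $\mathbb R$-bilinear form on $\mathfrak u^{\mathbb C}=\mathfrak u\oplus i\mathfrak u$, positive definite on $i\mathfrak u$, negative definite on $\mathfrak u$, with $\mathfrak u\perp i\mathfrak u$; $\langle\cdot,\cdot\rangle$ is its restriction to $i\mathfrak u$. $\mathrm G\subseteq\mathrm U^{\mathbb C}$ is a compatible subgroup, i.e. a closed connected subgroup with $\mathrm G=\mathrm K\exp(\mathfrak p)$, where $\mathrm K=\mathrm G\cap\mathrm U$ and $\mathfrak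 p=\mathfrak g\cap i\mathfrak u$ is $\mathrm K$-stable. The $\mathrm G$-gradient map $\mu_{\mathfrak p}:Z\to\mathfrak p$ is $-i$ times the orthogonal projection of $\mu$ onto $i\mathfrak p\subset\mathfrak u$; conventions are normalized so that for every $\beta\in\mathfrak p$ the fundamental vector field $\beta_Z$, $\beta_Z(z)=\frac{d}{dt}|_{t=0}\exp(t\beta)\cdot z$, is the gradient of $\mu_{\mathfrak p}^\beta=\langle\mu_{\mathfrak p},\beta\rangle$ for the Kähler metric determined by $\omega$ and $J$. $M\subset Z$ is a compact $\mathrm G$-stable real submanifold, and $\mu_{\mathfrak p}$ also denotes the restriction to $M$; then $\beta_M$ is the gradient of $\mu^\beta_{\mathfrak p}|_M$ for the induced metric. Measures. $\mathscr P(M)$ is the set of Borel probability measures on $M$ with the weak$^*$ topology; $\mathrm G$ acts on it by pushforward, $g\cdot\nu=g_*\nu$. Abelian subgroup. $\mathfrak a\subset\mathfrak p$ is a Lie subalgebra of $\mathfrak g$ (necessarily Abelian), $\mathrm A=\exp(\mathfrak a)$, $\mu_{\mathfrak a}=\pi_{\mathfrak a}\circ\mu_{\mathfrak p}:M\to\mathfrak a$ with $\pi_{\mathfrak a}$ the orthogonal projection onto $\mathfrak a$, and $\mathfrak F_{\mathfrak a}:\mathscr P(M)\to\mathfrak a$, $\mathfrak F_{\mathfrak a}(\nu)=\int_M\mu_{\mathfrak a}(x)\,d\nu(x)$. $\mathrm A_\nu$ is the isotropy group of $\nu$ in $\mathrm A$. Unstable manifolds. For $\beta\in\mathfrak a$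 the function $\mu_{\mathfrak p}^\beta:M\to\mathbb R$ is Morse–Bott. If $c_1<\dots<c_r$ are its critical values, then $M=\bigsqcup_{j=1}^r W_j$, where $W_j$ is the set of $x\in M$ such that $\lim_{t\to+\infty}\exp(t\beta)\cdot x$ is a critical point of $\mu_{\mathfrak p}^\beta$ at level $c_j$ (the ''unstable manifold'' for the gradient flow). ''Unique local maximum'' means that every local maximum of $\mu_{\mathfrak p}^\beta$ is a global maximum. Under the assumption that this holds for every $\beta\in\mathfrak a$, it is known that $P=\mu_{\mathfrak a}(M)$ is a (convex) polytope and, for each $\beta$, $W_r$ is open and dense while the other $W_j$ are submanifolds of positive codimension. $\mathscr W(M,\mathrm A)$ denotes the set of $\nu\in\mathscr P(M)$ such that, for every $\beta\in\mathfrak a$, the open unstable manifold $W_r=W_r(\beta)$ has full $\nu$-measure. *)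

(* Defs.v *)
From HB Require Import structures.
From mathcomp Require Import all_boot all_order all_algebra.
From mathcomp Require Import all_classical all_reals all_analysis.
Set Implicit Arguments.
Unset Strict Implicit.
Unset Printing Implicit Defensive.
Import Order.TTheory GRing.Theory Num.Theory.
Import numFieldNormedType.Exports.
Local Open Scope classical_set_scope.
Local Open Scope ring_scope.

#[short(type="topGroupType")]
HB.structure Definition TopGroup := {G of Group G & Topological G}.

(* Tangent vectors are row vectors in the coordinates of a chart.  A linear map
   acts on the right, so that J v is written v *m J, and bil W is the bilinear
   form with Gram matrix W. *)
Definition bil (R : realType) n (W : 'M[R]_n) (v w : 'rV[R]_n) : R :=
  (v *m W *m w^T) 0 0.

Section Manifolds.
Variable R : realType.

(* On an open set D this is the usual class C^k, by iterated partial
   derivatives. *)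
Fixpoint Ck n (V : normedModType R) (k : nat) (D : set 'rV[R]_n)
    (f : 'rV[R]_n -> V) : Prop :=
  match k with
  | 0 => forall x, D x -> {for x, continuous f}
  | k'.+1 => (forall x, D x -> differentiable f x) /\
      forall i : 'I_n, Ck k' D (fun x => 'D_(delta_mx 0 i) f x)
  end.

Definition smooth_on n (V : normedModType R) (D : set 'rV[R]_n)
    (f : 'rV[R]_n -> V) := forall k, Ck k D f.

(* coord and param are only meaningful on dom and coord @` dom. *)
Record chart (T : Type) (n : nat) := Chart {
  dom : set T;
  coord : T -> 'rV[R]_n;
  param : 'rV[R]_n -> T }.

Definition chart_image T n (c : chart T n) := coord c @` dom c.

Record is_chart (T : topologicalType) n (c : chart T n) : Prop := IsChart {
  open_dom : open (dom c);
  open_chart_image : open (chart_image c);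
  coordK : forall z, dom c z -> param c (coord c z) = z;
  coord_continuous : forall z, dom c z -> {for z, continuous (coord c)};
  param_continuous :
    forall x, chart_image c x -> {for x, continuous (param c)} }.

(* The map f read in charts, and the open set on which this makes sense.
   Transition maps are the case f = id. *)
Definition local_rep T n S m (c : chart T n) (d : chart S m) (f : T -> S) :=
  coord d \o f \o param c.
Definition local_dom T n S m (c : chart T n) (d : chart S m) (f : T -> S) :=
  coord c @` (dom c `&` f @^-1` dom d).

Definition smooth_map (T S : topologicalType) n m (A : set (chart T n))
    (A' : set (chart S m)) (f : T -> S) :=
  continuous f /\ forall c d, A c -> A' d ->
    smooth_on (local_dom c d f) (local_rep c d f).

(* J and J' are the complex structures of the model spaces R^n and R^m. *)
Definition holomorphic (T S : topologicalType) n m (J : 'M[R]_n)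
    (A : set (chart T n)) (J' : 'M[R]_m) (A' : set (chart S m)) (f : T -> S) :=
  smooth_map A A' f /\ forall c d, A c -> A' d ->
    forall x, local_dom c d f x -> forall v : 'rV[R]_n,
      'D_(v *m J) (local_rep c d f) x = 'D_v (local_rep c d f) x *m J'.

(* A complex manifold of real dimension n: the model space is R^n with a fixed
   linear complex structure J, and the transition maps are holomorphic. *)
Record is_complex_manifold (T : topologicalType) n (J : 'M[R]_n)
    (A : set (chart T n)) : Prop := IsComplexManifold {
  complex_structure : J *m J = - 1%:M;
  manifold_hausdorff : hausdorff_space T;
  manifold_second_countable : @second_countable T;
  atlas_is_chart : forall c, A c -> is_chart c;
  atlas_cover : forall z : T, exists2 c, A c & dom c z;
  atlas_compatible : holomorphic J A J A id }.

Record complexManifold := ComplexManifold {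
  cm_sort :> topologicalType;
  cm_dim : nat;
  cm_J : 'M[R]_cm_dim;
  atlas : set (chart cm_sort cm_dim);
  cmP : is_complex_manifold cm_J atlas }.

Definition prod_chart T S n m (c : chart T n) (d : chart S m) :
    chart (T * S) (n + m) :=
  Chart (dom c `*` dom d) (fun z => row_mx (coord c z.1) (coord d z.2))
    (fun x => (param c (lsubmx x), param d (rsubmx x))).

Definition prod_atlas T S n m (A : set (chart T n)) (A' : set (chart S m)) :
    set (chart (T * S) (n + m)) :=
  [set e | exists c d, [/\ A c, A' d & e = prod_chart c d]].

Definition prod_J n m (J : 'M[R]_n) (J' : 'M[R]_m) : 'M[R]_(n + m) :=
  block_mx J 0 0 J'.

(* M is an embedded d-dimensional submanifold: around each of its points it is
   a coordinate slice for some chart of the underlying smooth manifold, which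
   need not be a holomorphic chart. *)
Definition is_submanifold (T : topologicalType) n (A : set (chart T n)) (d : nat)
    (M : set T) :=
  forall z, M z -> exists c : chart T n,
    [/\ is_chart c, dom c z,
     forall c', A c' -> smooth_on (local_dom c c' id) (local_rep c c' id) /\
                        smooth_on (local_dom c' c id) (local_rep c' c id) &
     forall y, dom c y ->
       (M y <-> forall i : 'I_n, (d <= i)%N -> coord c y 0 i = 0)].

Definition velocity T n (c : chart T n) (gamma : R -> T) : 'rV[R]_n :=
  'D_1 (coord c \o gamma) 0.

End Manifolds.

Section Kahler.
Variables (R : realType) (Z : complexManifold R).
Local Notation n := (cm_dim Z).

(* A 2-form is given by its Gram matrices in the charts. *)
Definition form2 := chart R Z n -> 'rV[R]_n -> 'M[R]_n.

Definition preserves (omega : form2) (f : Z -> Z) :=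
  forall c d, atlas c -> atlas d -> forall x, local_dom c d f x -> forall v w,
    bil (omega d (local_rep c d f x))
      ('D_v (local_rep c d f) x) ('D_w (local_rep c d f) x)
    = bil (omega c x) v w.

(* The Kahler metric is g(v, w) = omega(v, J w). *)
Definition kmetric (omega : form2) c x (v w : 'rV[R]_n) :=
  bil (omega c x) v (w *m cm_J Z).

Record is_kahler (omega : form2) : Prop := IsKahler {
  kahler_smooth : forall c, atlas c -> smooth_on (chart_image c) (omega c);
  kahler_compatible : preserves omega id;
  kahler_alternating : forall c x, atlas c -> chart_image c x ->
    (omega c x)^T = - omega c x;
  kahler_closed : forall c x, atlas c -> chart_image c x -> forall i j l,
    'D_(delta_mx 0 i) (fun y => omega c y j l) x
    + 'D_(delta_mx 0 j) (fun y => omega c y l i) x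
    + 'D_(delta_mx 0 l) (fun y => omega c y i j) x = 0;
  kahler_J : forall c x, atlas c -> chart_image c x -> forall v w,
    bil (omega c x) (v *m cm_J Z) (w *m cm_J Z) = bil (omega c x) v w;
  kahler_pos : forall c x, atlas c -> chart_image c x -> forall v,
    v != 0 -> 0 < kmetric omega c x v v }.

End Kahler.

Section LieGroups.
Variable R : realType.

(* The Lie algebra is the tangent space at 1, in the coordinates of the chart
   lg_chart1.  The last field says that t |-> exp(t v) is the one-parameter
   subgroup with velocity v, which determines exp. *)
Record complexLieGroup := ComplexLieGroup {
  lg_sort :> topGroupType;
  lg_dim : nat;
  lg_J : 'M[R]_lg_dim;
  lg_atlas : set (chart R lg_sort lg_dim);
  lg_manifold : is_complex_manifold lg_J lg_atlas;
  lg_mul : holomorphic (prod_J lg_J lg_J) (prod_atlas lg_atlas lg_atlas)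
    lg_J lg_atlas (fun x : lg_sort * lg_sort => (x.1 * x.2)%g);
  lg_inv : holomorphic lg_J lg_atlas lg_J lg_atlas
    (fun x : lg_sort => (x^-1)%g);
  lg_chart1 : chart R lg_sort lg_dim;
  lg_chart1_atlas : lg_atlas lg_chart1;
  lg_chart1_dom : dom lg_chart1 1%g;
  lg_exp : 'rV[R]_lg_dim -> lg_sort;
  lg_expP : forall v : 'rV[R]_lg_dim,
    [/\ forall s t : R,
          lg_exp ((s + t) *: v) = (lg_exp (s *: v) * lg_exp (t *: v))%g,
        continuous (fun t : R => lg_exp (t *: v)) &
        is_derive (0 : R) 1 (fun t => coord lg_chart1 (lg_exp (t *: v))) v] }.

Variable UC : complexLieGroup.
Local Notation k := (lg_dim UC).
Local Notation exp := (@lg_exp UC).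
Local Notation J := (lg_J UC).

Definition Ad (g : UC) (v : 'rV[R]_k) : 'rV[R]_k :=
  velocity (lg_chart1 UC) (fun t => g * exp (t *: v) * g^-1)%g.

Definition bracket (v w : 'rV[R]_k) : 'rV[R]_k :=
  'D_1 (fun t : R => Ad (exp (t *: v)) w) 0.

Definition is_subgroup (H : set UC) :=
  [/\ H 1%g, forall x y, H x -> H y -> H (x * y)%g &
      forall x, H x -> H (x^-1)%g].

(* For a closed subgroup H this is its Lie algebra. *)
Definition lie_alg (H : set UC) : set 'rV[R]_k :=
  [set v | forall t : R, H (exp (t *: v))].

Definition imul (V : {vspace 'rV[R]_k}) : {vspace 'rV[R]_k} :=
  (linfun (mulmxr J) @: V)%VS.

(* UC is the complexification of its compact connected subgroup U, with Lie
   algebra u: the universal property, together with u^C = u (+) iu and the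
   Cartan decomposition. *)
Record is_complexification (U : set UC) (u : {vspace 'rV[R]_k}) : Prop :=
  IsComplexification {
  cx_subgroup : is_subgroup U;
  cx_compact : compact U;
  cx_connected : connected U;
  cx_lie : forall v, v \in u <-> lie_alg U v;
  cx_universal : forall (H : complexLieGroup) (phi : UC -> H),
    {within U, continuous phi} ->
    (forall x y, U x -> U y -> phi (x * y)%g = (phi x * phi y)%g) ->
    exists! psi : UC -> H,
      [/\ holomorphic J (@lg_atlas UC) (lg_J H) (@lg_atlas H) psi,
          forall x y, psi (x * y)%g = (psi x * psi y)%g &
          forall x, U x -> psi x = phi x];
  cx_sum : (u + imul u)%VS = fullv;
  cx_direct : (u :&: imul u)%VS = 0%VS;
  cx_cartan : forall g : UC, exists! x : UC * 'rV[R]_k,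
    [/\ U x.1, x.2 \in imul u & g = (x.1 * exp x.2)%g] }.

Record is_invariant_form (u : {vspace 'rV[R]_k}) (B : 'M[R]_k) : Prop :=
  IsInvariantForm {
  form_sym : B^T = B;
  form_nondegenerate : B \in unitmx;
  form_invariant : forall g v w, bil B (Ad g v) (Ad g w) = bil B v w;
  form_pos : forall v, v \in imul u -> v != 0 -> 0 < bil B v v;
  form_neg : forall v, v \in u -> v != 0 -> bil B v v < 0;
  form_orth : forall v w, v \in u -> w \in imul u -> bil B v w = 0 }.

(* Q is an Ad(U)-invariant scalar product on u; its values off u are
   irrelevant. *)
Record is_invariant_scalar_product (U : set UC) (u : {vspace 'rV[R]_k})
    (Q : 'M[R]_k) : Prop := IsInvariantScalarProduct {
  sp_sym : forall v w, v \in u -> w \in u -> bil Q v w = bil Q w v;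
  sp_pos : forall v, v \in u -> v != 0 -> 0 < bil Q v v;
  sp_invariant : forall g v w, U g -> v \in u -> w \in u ->
    bil Q (Ad g v) (Ad g w) = bil Q v w }.

(* The orthogonal projection onto V, for a form Q that is positive definite on
   V. *)
Definition orth_proj (Q : 'M[R]_k) (V : {vspace 'rV[R]_k}) (v : 'rV[R]_k) :
    'rV[R]_k :=
  xget 0 [set w | w \in V /\ forall x, x \in V -> bil Q (v - w) x = 0].

Record is_compatible (U : set UC) (u : {vspace 'rV[R]_k}) (G : set UC)
    (p : {vspace 'rV[R]_k}) : Prop := IsCompatible {
  compat_subgroup : is_subgroup G;
  compat_closed : closed G;
  compat_connected : connected G;
  compat_p : forall v, v \in p <-> (lie_alg G v /\ v \in imul u);
  compat_stable : forall g v, G g -> U g -> v \in p -> Ad g v \in p;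
  compat_cartan :
    G = [set (x.1 * exp x.2)%g | x in (G `&` U) `*` [set v | v \in p]] }.

Definition is_subalgebra_of (p a : {vspace 'rV[R]_k}) :=
  (a <= p)%VS /\ forall v w, v \in a -> w \in a -> bracket v w \in a.

Variable Z : complexManifold R.
Local Notation n := (cm_dim Z).

Record is_holomorphic_action (act : UC -> Z -> Z) : Prop :=
  IsHolomorphicAction {
  act1 : forall z, act 1%g z = z;
  actM : forall g h z, act (g * h)%g z = act g (act h z);
  act_holomorphic : holomorphic (prod_J J (cm_J Z))
    (prod_atlas (@lg_atlas UC) (@atlas _ Z)) (cm_J Z) (@atlas _ Z)
    (fun x : UC * Z => act x.1 x.2) }.

Variable act : UC -> Z -> Z.

Definition fund (c : chart R Z n) (v : 'rV[R]_k) (z : Z) : 'rV[R]_n :=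
  velocity c (fun t => act (exp (t *: v)) z).

(* mu : Z -> u, where u is identified with its dual by Q.  With the metric
   g(v, w) = omega(v, J w) and d<mu, xi> = omega(., xi_Z), the gradient of
   <mu, i beta> is beta_Z, since (i beta)_Z = J beta_Z. *)
Record is_momentum_map (U : set UC) (u : {vspace 'rV[R]_k}) (Q : 'M[R]_k)
    (omega : form2 Z) (mu : Z -> 'rV[R]_k) : Prop := IsMomentumMap {
  mom_u : forall z, mu z \in u;
  mom_smooth : forall c, atlas c -> smooth_on (chart_image c) (mu \o param c);
  mom_equivariant : forall g z, U g -> mu (act g z) = Ad g (mu z);
  mom_hamiltonian : forall xi, xi \in u -> forall c z, atlas c -> dom c z ->
    forall v, 'D_v (fun x => bil Q (mu (param c x)) xi) (coord c z)
      = bil (omega c (coord c z)) v (fund c xi z) }.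

(* -i times the orthogonal projection of mu onto ip. *)
Definition mu_p (Q : 'M[R]_k) (p : {vspace 'rV[R]_k}) (mu : Z -> 'rV[R]_k)
    (z : Z) : 'rV[R]_k :=
  - (orth_proj Q (imul p) (mu z) *m J).

(* The fundamental vector field of beta is the gradient of f for the Kahler
   metric. *)
Definition is_gradient (omega : form2 Z) (f : Z -> R) (beta : 'rV[R]_k) :=
  forall c z, atlas c -> dom c z -> forall v,
    'D_v (f \o param c) (coord c z)
    = kmetric omega c (coord c z) v (fund c beta z).

End LieGroups.

(* The space M with its Borel sigma-algebra.  A measurableType has to be
   pointed; the base point x0 plays no role in the sigma-algebra. *)
Definition pointed_at (T : choiceType) (x0 : T) : Type := T.
HB.instance Definition _ (T : choiceType) (x0 : T) :=
  Choice.copy (pointed_at x0) T.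
HB.instance Definition _ (T : choiceType) (x0 : T) :=
  isPointed.Build (pointed_at x0) x0.

Definition borel (T : topologicalType) (x0 : T) :=
  @g_sigma_algebraType (pointed_at x0) (@open T).
HB.instance Definition _ (T : topologicalType) (x0 : T) :=
  Measurable.on (borel x0).

Section Measures.
Variables (R : realType) (Z : complexManifold R) (UC : complexLieGroup R).
Variables (act : UC -> Z -> Z) (M : set Z) (x0 : set_type M).
Local Notation k := (lg_dim UC).
Local Notation exp := (@lg_exp _ UC).

(* The action of g on M; the default value x is never used if M is g-stable. *)
Definition act_on (g : UC) (x : set_type M) : set_type M :=
  insubd x (act g (val x)).

Definition push (g : UC) (nu : set (borel x0) -> \bar R) : set (borel x0) -> \bar R :=
  pushforward nu (act_on g : borel x0 -> borel x0).

Definition unique_local_max (f : set_type M -> R) :=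
  forall x, (\forall y \near x, f y <= f x) -> forall y, f y <= f x.

(* x is critical for f on M: f has zero derivative along all curves in M
   through x that are differentiable as curves in Z. *)
Definition critical (f : set_type M -> R) (x : set_type M) :=
  forall gamma : R -> set_type M, gamma 0 = x -> {for 0, continuous gamma} ->
    (forall c : chart R Z (cm_dim Z), atlas c -> dom c (val x) ->
       derivable (fun t => coord c (val (gamma t))) 0 1) ->
    is_derive (0 : R) 1 (f \o gamma) 0.

Definition critical_value (f : set_type M -> R) : set R := f @` critical f.

(* The points flowing, as t tends to +oo, to a critical point at level c. *)
Definition unstable (f : set_type M -> R) (beta : 'rV[R]_k) (c : R) :
    set (set_type M) :=
  [set x | exists y, [/\ (fun t : R => act_on (exp (t *: beta)) x) @ +oo --> y,
                         critical f y & f y = c]].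

(* W_r: the stratum of the largest critical value. *)
Definition top_unstable (f : set_type M -> R) (beta : 'rV[R]_k) :
    set (set_type M) :=
  [set x | exists c, [/\ critical_value f c,
     forall c', critical_value f c' -> c' <= c & unstable f beta c x]].

(* The vector-valued integral of mua against nu, coordinatewise. *)
Definition gradient_mean (mua : set_type M -> 'rV[R]_k)
    (nu : set (borel x0) -> \bar R) : 'rV[R]_k :=
  \row_(j < k) fine (\int[nu]_(x in [set: borel x0]) (mua x 0 j)%:E)%E.

Definition exp_group (a : {vspace 'rV[R]_k}) : set UC :=
  [set exp v | v in [set v | v \in a]].

Definition isotropy (A : set UC) (nu : set (borel x0) -> \bar R) : set UC :=
  [set g | A g /\ forall S, measurable S -> push g nu S = nu S].

Definition interior_in (a : {vspace 'rV[R]_k}) (P : set 'rV[R]_k) :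
    set 'rV[R]_k :=
  [set v | v \in a /\ \forall w \near v, w \in a -> P w].

End Measures.

(* Main.v *)
(** Choosing a basis identifies [a] with row vectors and [mua] with a bounded map
    [m]; since [iu, iu] lies in [u], the algebra [a] is abelian and [exp] turns
    addition in [a] into a flow [tau] with [tau (y + z) = tau y \o tau z].

    Let O be the set of [xi] such that every [b <> 0] admits a point [x] with
    <xi, b> < <m x, b>, that is, the interior of the convex hull of the image of [m].
    Both [y |-> m (tau y x)] and its mean T over [nu] are continuous, and monotone
    because the action of [exp (t b)] is the gradient flow of <m, b>.
    - If [x] lies in the open unstable manifolds of the countably many rational
      directions, then <m (tau (s b) x), b> tends to the maximum of <m, b> for these
      [b]. Monotonicity makes [y |-> m (tau y x) - xi] coercive for [xi] in O, and a
      coercive continuous monotone map of a Euclidean space has a zero. Hence O is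
      contained in the image of [m], and it is the interior of that image.
    - Dominated convergence gives the same limits for T, so O is contained in the
      image of T.
    - If T y is not in O, some [b <> 0] satisfies <m x, b> <= <T y, b> for all [x].
      The function <m, b> then equals its mean almost everywhere along [tau y], so
      [tau b] does not increase it and fixes almost every point [tau y x]; thus
      [tau b] lies in the isotropy group of [nu], whence [b = 0]. *)

Require Import Defs.
From HB Require Import structures.
From mathcomp Require Import all_boot all_order all_algebra.
From mathcomp Require Import all_classical all_reals all_analysis.
From mathcomp Require Import measurable_realfun.
From mathcomp Require Import ring lra.
(* Again, so that [coord] is the chart coordinate and not [vector.coord]. *)
Import Defs.
Import Order.TTheory GRing.Theory Num.Theory.
Import numFieldNormedType.Exports.
Local Open Scope classical_set_scope.
Local Open Scope ring_scope.
Set Implicit Arguments. Unset Strict Implicit. Unset Printing Implicit Defensive.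

(** * Continuity of compositions, sums and coordinates *)

Lemma continuousT_comp (X Y S : topologicalType) (f : X -> Y) (g : Y -> S) :
  continuous f -> continuous g -> continuous (fun x => g (f x)).
Proof. by move=> cf cg x; exact (continuous_comp (cf x) (cg (f x))). Qed.

Lemma sum_continuous (R : numFieldType) (V : normedModType R)
    (T : topologicalType) (I : Type) (r : seq I) (F : I -> T -> V) :
  (forall i, continuous (F i)) -> continuous (fun x => \sum_(i <- r) F i x).
Proof.
move=> cF x; elim: r => [|i r IH].
  under eq_fun do rewrite big_nil.
  exact: cvg_cst.
under eq_fun do rewrite big_cons.
by apply: cvgD => //; exact: cF.
Qed.

Lemma continuous_coord (R : numFieldType) n (T : topologicalType)
    (f : T -> 'rV[R]_n) i x :
  {for x, continuous f} -> {for x, continuous (fun x => f x 0 i)}.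
Proof.
by move=> cf; exact (continuous_comp cf (@matrix_normedtype.coord_continuous R 1 n 0 i (f x))).
Qed.

(** * Monotone maps of Euclidean space *)

Section Dot.
Variables (R : realType) (n : nat).
Implicit Types u v w : 'rV[R]_n.

Definition dot u v : R := \sum_i u 0 i * v 0 i.

Lemma dotC u v : dot u v = dot v u.
Proof. by apply: eq_bigr => i _; rewrite mulrC. Qed.

Lemma dotDl u v w : dot (u + v) w = dot u w + dot v w.
Proof. by rewrite /dot -big_split; apply: eq_bigr => i _; rewrite mxE mulrDl. Qed.

Lemma dotZl (k : R) u w : dot (k *: u) w = k * dot u w.
Proof. by rewrite /dot mulr_sumr; apply: eq_bigr => i _; rewrite mxE mulrA. Qed.

Lemma dotNl u w : dot (- u) w = - dot u w.
Proof. by rewrite -scaleN1r dotZl mulN1r. Qed.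

Lemma dotBl u v w : dot (u - v) w = dot u w - dot v w.
Proof. by rewrite dotDl dotNl. Qed.

Lemma dotDr u v w : dot w (u + v) = dot w u + dot w v.
Proof. by rewrite !(dotC w) dotDl. Qed.

Lemma dotZr (k : R) u w : dot w (k *: u) = k * dot w u.
Proof. by rewrite !(dotC w) dotZl. Qed.

Lemma dotBr u v w : dot w (u - v) = dot w u - dot w v.
Proof. by rewrite !(dotC w) dotBl. Qed.

Lemma dot0l u : dot 0 u = 0.
Proof. by rewrite -(scale0r 0) dotZl mul0r. Qed.

Lemma dot0r u : dot u 0 = 0.
Proof. by rewrite dotC dot0l. Qed.

Lemma mxnorm_ge u i : `|u 0 i| <= `|u|.
Proof.
rewrite [leRHS]mx_normrE.
exact: (@le_bigmax_cond _ _ _ _ (0, i) predT (fun ij => `|u ij.1 ij.2|)).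
Qed.

Lemma mxnorm_le u (k : R) : 0 <= k -> (forall i, `|u 0 i| <= k) -> `|u| <= k.
Proof.
move=> k0 uk; rewrite [leLHS]mx_normrE; apply/bigmax_leP; split=> // -[a i] _ /=.
by rewrite (ord1 a).
Qed.

(** The norm is the sup norm: it is attained at some coordinate, whose square is one of the
    nonnegative summands. *)
Lemma dot_ge_norm u : `|u| ^+ 2 <= dot u u.
Proof.
have [->|u0] := eqVneq u 0; first by rewrite normr0 expr0n dot0l.
have : mx_norm u != 0 by move: u0; apply: contra => /eqP/mx_norm_eq0 ->.
move=> /mx_norm_neq0[[a i] /=]; rewrite (ord1 a) -[mx_norm u]/`|u| => ->.
rewrite /dot (bigD1 i) //= real_normK ?num_real // -expr2 lerDl.
by apply: sumr_ge0 => j _; rewrite -expr2 sqr_ge0.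
Qed.

Lemma dot_gt0 u : u != 0 -> 0 < dot u u.
Proof.
by move=> u0; apply: lt_le_trans (dot_ge_norm u); rewrite exprn_gt0 // normr_gt0.
Qed.

(** A crude substitute for Cauchy-Schwarz in the sup norm: each of the [n] summands is at most the
    product of the norms. *)
Lemma dot_le_norm u v : `|dot u v| <= n%:R * `|u| * `|v|.
Proof.
apply: (le_trans (ler_norm_sum _ _ _)).
rewrite -mulrA mulr_natl -[X in _ *+ X]card_ord -sumr_const.
apply: ler_sum => i _; rewrite normrM.
by apply: ler_pM => //; exact: mxnorm_ge.
Qed.

Lemma dot_continuous (T : topologicalType) (f g : T -> 'rV[R]_n) :
  continuous f -> continuous g -> continuous (fun x => dot (f x) (g x)).
Proof.
move=> cf cg; apply: sum_continuous => i x.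
exact: (cvgM (continuous_coord (i:=i) (cf x)) (continuous_coord (i:=i) (cg x))).
Qed.

End Dot.

Lemma continuous_rV (R : realType) n (T : topologicalType) (f : T -> 'rV[R]_n) :
  (forall i, continuous (fun x => f x 0 i)) -> continuous f.
Proof.
move=> cf x; apply/cvgrPdist_lt => e e0.
have H : \forall y \near x, forall i, `|f x 0 i - f y 0 i| < e / 2.
  apply: filter_forall => i; have /cvgrPdist_lt := cf i x; apply.
  by rewrite divr_gt0.
near=> y.
apply: (@le_lt_trans _ _ (e / 2)); last by lra.
apply: mxnorm_le; first by lra.
by move=> i; rewrite !mxE ltW //; move: i; near: y.
Unshelve. all: by end_near.
Qed.

Lemma linear_rV_continuous (R : realType) n (V : normedModType R)
  (f : {linear 'rV[R]_n -> V}) : continuous f.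
Proof.
have -> : (f : _ -> V) = fun x => \sum_i x 0 i *: f (delta_mx 0 i).
  apply/funext => x; rewrite {1}[x]row_sum_delta linear_sum.
  by apply: eq_bigr => i _; rewrite linearZ.
apply: sum_continuous => i x; exact: (cvgZr_tmp (@matrix_normedtype.coord_continuous _ _ _ 0 i x)).
Qed.

(** * Zeros of strongly monotone continuous maps *)

Section StronglyMonotone.
Variable R : realType.

Definition row_cons n (s : R) (u : 'rV[R]_n) : 'rV[R]_(1 + n) := row_mx s%:M u.

Lemma dot_row_mx m n (a b : 'rV[R]_m) (u v : 'rV[R]_n) :
  dot (row_mx a u) (row_mx b v) = dot a b + dot u v.
Proof.
rewrite /dot big_split_ord; congr (_ + _); apply: eq_bigr => i _.
  by rewrite !row_mxEl.
by rewrite !row_mxEr.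
Qed.

Lemma dot_row_consB n (s t : R) (u v : 'rV[R]_n) (w : 'rV[R]_(1 + n)) :
  dot w (row_cons s u - row_cons t v)
  = lsubmx w 0 0 * (s - t) + dot (rsubmx w) (u - v).
Proof.
rewrite /row_cons opp_row_mx add_row_mx -{1}[w]hsubmxK dot_row_mx.
by congr (_ + _); rewrite /dot big_ord1 !mxE !eqxx !mulr1n.
Qed.

Lemma row_cons_continuous n (T : topologicalType) (s : T -> R) (u : T -> 'rV[R]_n) :
  continuous s -> continuous u -> continuous (fun x => row_cons (s x) (u x)).
Proof.
move=> cs cu; apply: continuous_rV => i x.
rewrite -(splitK i); case: (fintype.split i) => j /=.
  under eq_fun do rewrite row_mxEl (ord1 j) mxE eqxx mulr1n.
  exact: cs.
under eq_fun do rewrite row_mxEr.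
exact: (continuous_coord (i := j) (cu x)).
Qed.

Definition strongly_monotone n (e : R) (T : 'rV[R]_n -> 'rV[R]_n) :=
  forall x y, e * dot (x - y) (x - y) <= dot (T x - T y) (x - y).

Lemma rsubmx_continuous m n (T : topologicalType) (f : T -> 'rV[R]_(m + n)) :
  continuous f -> continuous (fun x => rsubmx (f x)).
Proof.
move=> cf; apply: continuous_rV => i x; under eq_fun do rewrite mxE.
exact: continuous_coord (cf x).
Qed.

Definition has_zero n (e : R) := forall T : 'rV[R]_n -> 'rV[R]_n,
  continuous T -> strongly_monotone e T -> exists x, T x = 0.

(* For each value [s] of the first coordinate, solve for the others as a function
   [u s]; the remaining scalar equation is handled by the intermediate value theorem. *)
Lemma has_zero_cons n (e : R) : 0 < e -> has_zero n e -> has_zero (1 + n) e.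
Proof.
move=> e0 IH T cT mT.
have mT2 s : strongly_monotone e (fun u => rsubmx (T (row_cons s u))).
  move=> x y; have := mT (row_cons s x) (row_cons s y).
  rewrite !dot_row_consB subrr !mulr0 !add0r.
  by rewrite /row_cons opp_row_mx add_row_mx row_mxKr linearB.
have cTc (X : topologicalType) (a : X -> R) (b : X -> 'rV[R]_n) :
    continuous a -> continuous b -> continuous (fun x => T (row_cons (a x) (b x))).
  by move=> ca cb; exact (continuousT_comp (row_cons_continuous ca cb) cT).
have cid (X : topologicalType) : continuous (@id X) by move=> ?; exact: cvg_id.
have ccst (X Y : topologicalType) (y : Y) : continuous (fun _ : X => y).
  by move=> ?; exact: cvg_cst.
have cT2 s : continuous (fun u => rsubmx (T (row_cons s u))).
  exact: (rsubmx_continuous (cTc _ _ _ (ccst _ _ _) (cid _))).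
have /choice[u uP] s := IH _ (cT2 s) (mT2 s).
have cu : continuous u.
  (* Strong monotonicity at parameter [t], between [u s] and the zero [u t], gives e |u s - u t| <=
     n |rsubmx (T (row_cons t (u s)))|, and the right-hand side tends to 0 as [t] tends to [s]. The
     denominator [n.+1] also covers n = 0. *)
  move=> s; apply/cvgrPdist_lt => d d0.
  have cTs : continuous (fun t => rsubmx (T (row_cons t (u s)))).
    exact: (rsubmx_continuous (cTc _ _ _ (cid _) (ccst _ _ _))).
  have /cvgrPdist_lt /(_ (e * d / n.+1%:R)) := cTs s.
  rewrite uP => /(_ _)/wrap[|H]; first by rewrite divr_gt0 ?mulr_gt0 ?ltr0n.
  near=> t.
  have : `|rsubmx (T (row_cons t (u s)))| < e * d / n.+1%:R.
    by rewrite -[ltLHS]normrN -sub0r; near: t.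
  have := mT2 t (u s) (u t); rewrite uP subr0.
  set w := rsubmx _; set z := u s - u t => h1.
  rewrite ltr_pdivlMr ?ltr0n // => h2.
  have := le_trans h1 (ler_norm _) => /le_trans /(_ (dot_le_norm _ _)).
  have h4 := dot_ge_norm z.
  have h5 : e * `|z| ^+ 2 <= e * dot z z by rewrite ler_pM2l.
  move=> /(le_trans h5) h6.
  rewrite ltNge; apply/negP => dz.
  have z0 : 0 < `|z| by exact: lt_le_trans dz.
  move: h6; rewrite expr2 mulrA ler_pM2r // => h6.
  have h7 : n%:R * `|w| <= `|w| * n.+1%:R :> R.
    by rewrite mulrC ler_wpM2l // ler_nat.
  have : e * d <= e * `|z| by rewrite ler_pM2l.
  lra.
pose f s : R := lsubmx (T (row_cons s (u s))) 0 0.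
have cf : continuous f.
  move=> s; rewrite /f; under eq_fun do rewrite mxE.
  exact: (continuous_coord (cTc _ _ _ (cid _) cu s)).
have mf s t : e * (s - t) ^+ 2 <= (f s - f t) * (s - t).
  have := mT (row_cons s (u s)) (row_cons t (u t)).
  rewrite !dot_row_consB /row_cons opp_row_mx add_row_mx row_mxKr row_mxKl.
  rewrite linearB /= linearB /= !uP subrr dot0l addr0.
  rewrite /f !mxE !eqxx !mulr1n mulrDr -expr2.
  apply: le_trans; rewrite lerDl mulr_ge0 ?(ltW e0) //.
  by apply: le_trans (dot_ge_norm _); rewrite exprn_ge0.
(* For c > 0, comparing [f] with [f 0] by [mf] gives f c >= f 0 + e c and f (- c) <= f 0 - e c; with
   e c = |f 0| this brackets a sign change. *)
pose c := `|f 0| / e.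
have c0 : 0 <= c by rewrite divr_ge0 // ltW.
have ec : e * c = `|f 0| by rewrite /c mulrCA divff ?mulr1 // gt_eqF.
have f_ge : 0 <= f c /\ f (- c) <= 0.
  have [cE|cn0] := eqVneq c 0.
    have f0 : f 0 = 0 by apply/eqP; rewrite -normr_eq0 -ec cE mulr0.
    by rewrite cE oppr0 f0.
  have cp : 0 < c by rewrite lt_def cn0.
  have := ler_norm (f 0); have := ler_norm (- f 0); rewrite normrN.
  have := mf c 0; have := mf 0 (- c); rewrite opprK add0r subr0 expr2 mulrA.
  by rewrite !ler_pM2r // ec; split; lra.
case: f_ge => f_ge f_le.
have [|||s _ fs] := @IVT R f (- c) c 0.
- lra.
- exact: continuous_subspaceT.
- by rewrite ge_min f_le le_max f_ge orbT.
exists (row_cons s (u s)).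
rewrite -[LHS]hsubmxK uP.
have -> : lsubmx (T (row_cons s (u s))) = 0.
  by apply/rowP => i; rewrite (ord1 i) [RHS]mxE -fs.
by rewrite row_mx0.
Unshelve. all: by end_near.
Qed.

Lemma strongly_monotone_zero n (e : R) : 0 < e -> has_zero n e.
Proof.
move=> e0; elim: n => [T _ _|n]; last exact: has_zero_cons.
by exists 0; apply/rowP; case.
Qed.

End StronglyMonotone.

Definition monotone_rV (R : realType) n (T : 'rV[R]_n -> 'rV[R]_n) :=
  forall x y, 0 <= dot (T x - T y) (x - y).

(** Adding a small multiple of the identity makes [T] strongly monotone, and coercivity confines the
    resulting zero to the ball of radius [rho]. Instead of letting the multiple tend to 0, the
    argument compares with the minimum of |T| on that compact ball. *)
Lemma monotone_zero (R : realType) n (rho : R) (T : 'rV[R]_n -> 'rV[R]_n) :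
  continuous T -> monotone_rV T ->
  (forall y, rho <= `|y| -> 0 < dot (T y) y) -> exists y, T y = 0.
Proof.
move=> cT mT coer.
have rho0 : 0 < rho.
  rewrite ltNge; apply/negP => rho0.
  by have := coer 0; rewrite normr0 dot0r ltxx => /(_ rho0).
pose K := [set y : 'rV[R]_n | `|y| <= rho].
have [||| c cK cmin] := @EVT_min_rV R n (fun y => `|T y|) K.
- by exists 0; rewrite /K /= normr0 ltW.
- apply: bounded_closed_compact.
    by exists rho; split; [exact: num_real|move=> x rx y /le_trans; apply; exact: ltW].
  have -> : K = (fun x => `|x|) @^-1` [set x | x <= rho] by [].
  by apply: preimage_closed; [move=> ? _; exact: norm_continuous|exact: closed_le].
- apply: continuous_subspaceT.
  exact (continuousT_comp cT (@norm_continuous _ _)).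
apply: contrapT => /forallNP nT.
have m0 : 0 < `|T c| by rewrite normr_gt0; apply/eqP.
(* The zero [y] of [T + e id] has |T y| = e |y| < |T c|, against the minimality of [c]. *)
pose e := `|T c| / (2 * rho).
have e0 : 0 < e by rewrite divr_gt0 // mulr_gt0.
have [||y] := @strongly_monotone_zero R n e e0 (fun x => T x + e *: x).
- move=> x; exact (cvgD (cT x) (cvgZl_tmp (k := e) (@cvg_id _ (nbhs x)))).
- move=> x y; rewrite opprD addrACA -scalerBr [dot (_ + e *: _) _]dotDl dotZl lerDr; exact: mT.
move=> /eqP; rewrite addr_eq0 => /eqP Ty.
have yrho : `|y| < rho.
  rewrite ltNge; apply/negP => /coer; rewrite Ty dotNl dotZl oppr_gt0.
  apply/negP; rewrite -leNgt mulr_ge0 ?(ltW e0) //.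
  by apply: le_trans (dot_ge_norm y); rewrite exprn_ge0.
have := cmin y; rewrite inE => /(_ (ltW yrho)).
rewrite Ty normrN normrZ (gtr0_norm e0); apply/negP; rewrite -ltNge.
apply: (@le_lt_trans _ _ (e * rho)); first by rewrite ler_pM2l // ltW.
have -> : e * rho = `|T c| / 2 by rewrite /e; field; rewrite gt_eqF.
by lra.
Qed.

Lemma rat_dense_rV (R : realType) n (b : 'rV[R]_n) (e : R) :
  0 < e -> exists q : 'rV[rat]_n, `|map_mx ratr q - b| < e.
Proof.
move=> e0.
have H i : exists q : rat, `|ratr q - b 0 i| <= e / 2.
  have [|q] := @rat_in_itvoo R (b 0 i) (b 0 i + e / 2); first by lra.
  rewrite in_itv /= => /andP[h1 h2]; exists q; rewrite ler_norml; apply/andP; split; lra.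
have /choice[f fP] := H.
exists (\row_i f i); apply: (@le_lt_trans _ _ (e / 2)); last by lra.
by apply: mxnorm_le => [|i]; [lra|rewrite !mxE].
Qed.

Section Asymptotic.
Variables (R : realType) (n : nat) (X : Type) (m : X -> 'rV[R]_n).

(** This is the set O of the overview. Describing it by half-spaces makes it directly comparable
    with monotonicity, which is also tested direction by direction. *)
Definition supported : set 'rV[R]_n :=
  [set xi | forall b, b != 0 -> exists x, dot xi b < dot (m x) b].

(** The asymptotic lower bound makes [T - xi] coercive, uniformly in the direction because the unit
    sphere is compact; then [monotone_zero] applies. Only rational directions enter the hypothesis,
    since countably many almost-everywhere conditions hold at a common point. *)
Lemma monotone_surj (L : R) (T : 'rV[R]_n -> 'rV[R]_n) xi :
  continuous T -> monotone_rV T -> (forall y, `|T y| <= L) ->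
  (forall (q : 'rV[rat]_n) x e, 0 < e ->
     \forall s \near +oo, dot (m x) (map_mx ratr q) - e
       <= dot (T (s *: map_mx ratr q)) (map_mx ratr q)) ->
  supported xi -> exists y, T y = xi.
Proof.
move=> cT mT bT asym sxi.
pose S y := T y - xi.
have cS : continuous S by move=> y; exact (cvgB (cT y) (cvg_cst xi)).
have mS : monotone_rV S by move=> x y; rewrite /S opprD addrACA subrr addr0.
pose C := n%:R * (L + `|xi|).
have L0 : 0 <= L := le_trans (normr_ge0 _) (bT 0).
have C0 : 0 <= C by rewrite mulr_ge0 // addr_ge0.
have bS y w : `|dot (S y) w| <= C * `|w|.
  apply: (le_trans (dot_le_norm _ _)); rewrite ler_wpM2r // ler_wpM2l //.
  by rewrite (le_trans (ler_normB _ _)) // lerD2r.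
(* Monotonicity carries the asymptotic bound at a nearby rational [q], at time [s / 2],
   to every unit vector [b] close to [q] at time [s]. *)
have scov : \forall s \near +oo, [set b | `|b| = 1] `<=` (fun b => 0 < dot (S (s *: b)) b).
  have : compact [set b : 'rV[R]_n | `|b| = 1].
    apply: bounded_closed_compact.
      by exists 1; split; [exact: num_real|move=> x rx y /= ->; exact: ltW].
    have -> : [set b : 'rV[R]_n | `|b| = 1] = (fun x => `|x|) @^-1` [set 1] by [].
    by apply: preimage_closed; [move=> ? _; exact: norm_continuous|exact: closed_eq].
  move=> /compact_near_coveringP; apply => b /= b1.
  have b0 : b != 0 by rewrite -normr_eq0 b1 oner_eq0.
  have [x xb] := sxi _ b0.
  pose d := dot (m x - xi) b.
  have d0 : 0 < d by rewrite /d dotBl subr_gt0.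
  pose C1 := n%:R * `|m x - xi|.
  have C10 : 0 <= C1 by rewrite mulr_ge0.
  have D0 : 0 < C1 + 6 * C + 1 by lra.
  (* The estimate below bounds the component of [S (s *: c)] along [c] from below by 3d/4 - (C1 + 6
     C) h. This [h] makes the bound positive, and the summand 1 keeps the denominator positive. *)
  pose h := d / 2 / (C1 + 6 * C + 1).
  have h0 : 0 < h by rewrite !divr_gt0.
  have hE : (C1 + 6 * C + 1) * h = d / 2 by rewrite /h; field; rewrite gt_eqF.
  have [q qb] := rat_dense_rV b h0.
  pose r : 'rV[R]_n := map_mx ratr q; rewrite -/r in qb.
  have d4 : 0 < d / 4 by lra.
  have [s0 [_ s0P]] := asym q x (d / 4) d4.
  exists ([set c | `|b - c| < h], [set s | 2 * `|s0| < s]).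
    split => /=; first by have /cvgrPdist_lt := @cvg_id _ (nbhs b); apply.
    by exists (2 * `|s0|); split; [exact: num_real|].
  case=> c s /= [cb s0s].
  have sp : 0 < s by apply: le_lt_trans s0s; rewrite mulr_ge0.
  have sp2 : s0 < s / 2 by rewrite ltr_pdivlMr // mulrC; apply: le_lt_trans s0s; rewrite ler_pM2l // ler_norm.
  have := s0P _ sp2; rewrite -/r => hE2.
  have cr : `|c - r| <= 2 * h.
    have -> : c - r = (b - r) - (b - c) by apply/rowP => i; rewrite !mxE; ring.
    rewrite (le_trans (ler_normB _ _)) // mulr_natl mulr2n lerD ?ltW //.
    by rewrite -normrN opprB.
  have := mS (s *: c) ((s / 2) *: r).
  have -> : s *: c - (s / 2) *: r = s *: (2^-1 *: c + 2^-1 *: (c - r)).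
    by apply/rowP => i; rewrite !mxE; field.
  rewrite dotZr pmulr_rge0 // dotBl dotDr !dotZr.
  have -> : 2^-1 *: c + 2^-1 *: (c - r) = 2^-1 *: r + (c - r).
    by apply/rowP => i; rewrite !mxE; field.
  rewrite [dot _ (2^-1 *: r + _)]dotDr [dot _ (2^-1 *: r)]dotZr.
  have := bS (s *: c) (c - r); have := bS ((s / 2) *: r) (c - r).
  have h5 : C * `|c - r| <= C * (2 * h) by rewrite ler_wpM2l.
  move=> /le_trans /(_ h5); rewrite ler_norml => /andP[h6 h7].
  move=> /le_trans /(_ h5); rewrite ler_norml => /andP[h8 h9].
  have h10 : dot (S ((s / 2) *: r)) r >= dot (m x - xi) r - d / 4.
    by rewrite [S _]/(_ - _) !dotBl; lra.
  have : `|dot (m x - xi) (r - b)| <= C1 * h.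
    by rewrite (le_trans (dot_le_norm _ _)) // ler_wpM2l // ltW.
  rewrite [dot _ (r - b)]dotBr -/d ler_norml => /andP[h11 h12].
  have h13 : C1 * h + C * h * 6 + h = d / 2 by rewrite -hE; ring.
  by lra.
case: scov => s0 [_ s0P].
have [|y Sy] := @monotone_zero R n (`|s0| + 1) S cS mS.
  move=> y yl.
  have y0 : 0 < `|y| by apply: lt_le_trans yl; rewrite ltr_wpDl.
  have := s0P `|y| _ (`|y|^-1 *: y).
  rewrite scalerA mulfV ?gt_eqF // scale1r dotZr pmulr_rgt0 ?invr_gt0 //; apply.
    apply: lt_le_trans yl; apply: (le_lt_trans (ler_norm _)).
    by rewrite ltrDl.
  by rewrite /= normrZ normfV normr_id mulVf // gt_eqF.
by exists y; apply/eqP; rewrite -subr_eq0; apply/eqP.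
Qed.

End Asymptotic.

(** From an interior point of the range a small step along [b] stays in the range and gains in
    direction [b]. Conversely [supported] is open: its defining inequality is open, and it suffices
    to test directions on the compact unit sphere. *)
Lemma near_interior_supported (R : realType) n (X : Type) (m : X -> 'rV[R]_n) :
  (forall xi, supported m xi -> exists x, m x = xi) ->
  [set v | \forall w \near v, exists x, m x = w] = supported m.
Proof.
move=> sm; apply/seteqP; split => [v /= vm b b0|xi sxi].
  have : \forall t \near (0 : R), exists x, m x = v + t *: b.
    have c : (fun t : R => v + t *: b) @ (0 : R) --> v.
      have {2}-> : v = v + (0 : R) *: b by rewrite scale0r addr0.
      exact (cvgD (cvg_cst v) (cvgZr_tmp (a := b) (@cvg_id _ (nbhs (0 : R))))).
    exact (c _ vm).
  move=> /nbhs_ballP[e /= e0 eP].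
  have [|x mx] := eP (e / 2).
    by rewrite /ball /= sub0r normrN gtr0_norm; lra.
  exists x; rewrite mx dotDl dotZl ltrDl mulr_gt0 ?dot_gt0 //; lra.
suff : \forall w \near xi, supported m w.
  by apply: filterS => w /sm.
have : compact [set b : 'rV[R]_n | `|b| = 1].
  apply: bounded_closed_compact.
    by exists 1; split; [exact: num_real|move=> x rx y /= ->; exact: ltW].
  have -> : [set b : 'rV[R]_n | `|b| = 1] = (fun x => `|x|) @^-1` [set 1] by [].
  by apply: preimage_closed; [move=> ? _; exact: norm_continuous|exact: closed_eq].
move=> /compact_near_coveringP/(_ _ (nbhs xi) (fun w b => exists x, dot w b < dot (m x) b)).
move=> /(_ _ _)/wrap[].
  move=> b /= b1.
  have b0 : b != 0 by rewrite -normr_eq0 b1 oner_eq0.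
  have [x xb] := sxi _ b0.
  have c : continuous (fun z : 'rV[R]_n * 'rV[R]_n => dot (m x - z.2) z.1).
    apply: dot_continuous; last by move=> z; exact: cvg_fst.
    have cs : continuous (@snd 'rV[R]_n 'rV[R]_n) by move=> z; exact: cvg_snd.
    by move=> z; exact (cvgB (cvg_cst (m x)) (cs z)).
  have /cvgr_gt /(_ 0) := c (b, xi).
  rewrite dotBl subr_gt0 => /(_ xb).
  by apply: filterS => -[b' w] /=; rewrite dotBl subr_gt0 => h; exists x.
apply: filterS => w wP b b0.
have nb0 : 0 < `|b| by rewrite normr_gt0.
have [|x] := wP (`|b|^-1 *: b).
  by rewrite /= normrZ normfV normr_id mulVf // gt_eqF.
by rewrite !dotZr ltr_pM2l ?invr_gt0 // => h; exists x.
Qed.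

(** Continuity is tested on sequences so that dominated convergence can be applied to integrals
    depending on a parameter. *)
Lemma seq_continuous_at (R : realType) (V W : normedModType R) (f : V -> W) p :
  (forall u : nat -> V, u @ \oo --> p -> (fun k => f (u k)) @ \oo --> f p) ->
  {for p, continuous f}.
Proof.
move=> H; apply/cvgrPdist_lt => e e0; apply: contrapT => nH.
have K k : exists y, `|p - y| < k.+1%:R^-1 /\ e <= `|f p - f y|.
  apply: contrapT => /forallNP nK; apply: nH.
  have : \forall y \near p, `|p - y| < k.+1%:R^-1.
    by have /cvgrPdist_lt := @cvg_id _ (nbhs p); apply; rewrite invr_gt0 ltr0n.
  apply: filterS => y py; rewrite ltNge; apply/negP => ey.
  exact: (nK y).
have /choice[u uP] := K.
have up : u @ \oo --> p.
  apply/cvgrPdist_lt => d d0.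
  have := near_infty_natSinv_lt (PosNum d0); apply: filterS => k.
  exact: lt_trans (uP k).1.
have /cvgrPdist_lt /(_ e e0) [N _ /(_ N (leqnn N))] := H u up.
by rewrite ltNge (uP N).2.
Qed.

(** * Means of vector-valued functions *)

Section Mean.
Variables (R : realType) (d : measure_display) (T : measurableType d).
Variable P : probability T R.

Lemma bounded_integrable (L : R) (f : T -> R) :
  measurable_fun setT f -> (forall x, `|f x| <= L) ->
  P.-integrable setT (EFin \o f).
Proof.
move=> mf fL; apply: measurable_bounded_integrable => //.
  by rewrite -ge0_fin_numE // fin_num_measure.
exists L; split; first exact: num_real.
by move=> x Lx y _ /=; apply: le_trans (fL y) (ltW Lx).
Qed.

Lemma integral_const (c : R) : (\int[P]_x c%:E = c%:E)%E.
Proof.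
rewrite integral_cst //.
have := @probability_setT _ _ _ P; set p := (X in (_ * X)%E) => pE.
by rewrite (_ : p = 1%E) ?mule1.
Qed.

Lemma Rintegral_const (c : R) : (\int[P]_x c)%R = c.
Proof. by rewrite /Rintegral integral_const. Qed.

Variable n : nat.
Implicit Types m : T -> 'rV[R]_n.

Definition mean m : 'rV[R]_n := \row_i (\int[P]_x m x 0 i)%R.

Definition measurable_coords m := forall i, measurable_fun setT (fun x => m x 0 i).

Lemma coord_integrable (L : R) m i : measurable_coords m -> (forall x, `|m x| <= L) ->
  P.-integrable setT (EFin \o (fun x => m x 0 i)).
Proof.
by move=> mm mL; apply: bounded_integrable => // x; exact: le_trans (mxnorm_ge _ _) (mL x).
Qed.

Lemma measurable_dot m b : measurable_coords m -> measurable_fun setT (fun x => dot (m x) b).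
Proof.
move=> mm; apply: measurable_sum => i.
by apply: measurable_funM.
Qed.

Lemma dot_integrable (L : R) m b : measurable_coords m -> (forall x, `|m x| <= L) ->
  P.-integrable setT (EFin \o (fun x => dot (m x) b)).
Proof.
move=> mm mL; apply: (@bounded_integrable (n%:R * L * `|b|)); first exact: measurable_dot.
move=> x; apply: le_trans (dot_le_norm _ _) _; rewrite ler_wpM2r // ler_wpM2l //.
Qed.

Lemma dot_mean (L : R) m b : measurable_coords m -> (forall x, `|m x| <= L) ->
  dot (mean m) b = (\int[P]_x dot (m x) b)%R.
Proof.
move=> mm mL; rewrite /dot.
(* Integrability of the partial sums is carried through the induction because additivity of the
   integral requires it. *)
have H (s : seq 'I_n) :
    P.-integrable setT (EFin \o (fun x => \sum_(i <- s) m x 0 i * b 0 i)) /\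
    \sum_(i <- s) mean m 0 i * b 0 i = (\int[P]_x (\sum_(i <- s) m x 0 i * b 0 i))%R.
  elim: s => [|i s [IH1 IH2]].
    have -> : (fun x => \sum_(i <- [::]) m x 0 i * b 0 i) = (cst 0 : T -> R).
      by apply/funext => x /=; rewrite big_nil.
    rewrite big_nil Rintegral_cst // mul0r; split => //.
    by apply: (@bounded_integrable 0 (cst 0)) => // x; rewrite normr0.
  have mi : P.-integrable setT (EFin \o (fun x => m x 0 i * b 0 i)).
    apply: (@bounded_integrable (L * `|b|)); first exact: measurable_funM.
    by move=> x; rewrite normrM ler_pM // ?mxnorm_ge // (le_trans (mxnorm_ge _ _)).
  have -> : (fun x => \sum_(j <- i :: s) m x 0 j * b 0 j) =
      (fun x => m x 0 i * b 0 i + \sum_(j <- s) m x 0 j * b 0 j).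
    by apply/funext => x; rewrite big_cons.
  rewrite RintegralD // big_cons IH2 mxE RintegralZr //; last exact: (coord_integrable _ mm mL).
  by split => //; exact: (integrableD measurableT mi IH1).
exact: (H _).2.
Qed.

Lemma norm_mean (L : R) m : measurable_coords m -> (forall x, `|m x| <= L) ->
  `|mean m| <= `|L|.
Proof.
move=> mm mL; apply: mxnorm_le => // i; rewrite mxE.
apply: le_trans (le_normr_Rintegral _ _) _ => //; first exact: (coord_integrable _ mm mL).
rewrite -(Rintegral_const `|L|).
apply: le_Rintegral => //.
- apply: (@bounded_integrable L).
    by apply: measurableT_comp => //; exact: mm.
  by move=> x; rewrite normr_id; exact: le_trans (mxnorm_ge _ _) (mL x).
- by apply: (@bounded_integrable `|L| (cst _)) => // x; rewrite normr_id.
- by move=> x _; apply: le_trans (mxnorm_ge _ _) (le_trans (mL x) (ler_norm _)).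
Qed.

Lemma mean_continuous (k : nat) (L : R) (F : 'rV[R]_k -> T -> 'rV[R]_n) :
  (forall y, measurable_coords (F y)) -> (forall y x, `|F y x| <= L) ->
  (forall x, continuous (F^~ x)) -> continuous (fun y => mean (F y)).
Proof.
move=> mF FL cF; apply: continuous_rV => i p; apply: seq_continuous_at => u up.
rewrite mxE; under eq_fun do rewrite mxE.
have [||||| _ _ H] := @dominated_convergence _ _ _ P setT measurableT
  (fun j x => (F (u j) x 0 i)%:E) (fun x => (F p x 0 i)%:E) (fun=> L%:E).
- by move=> j; apply/measurable_EFinP; exact: mF.
- by apply/measurable_EFinP; exact: mF.
- apply: aeW => x _; apply: cvg_EFin; first exact: nearW.
  exact (cvg_comp _ _ up (continuous_coord (i := i) (cF x p))).
- apply: (@bounded_integrable `|L| (cst L)) => //.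
- apply: aeW => x j _; rewrite lee_fin; exact: le_trans (mxnorm_ge _ _) (FL _ _).
have fin y : (\int[P]_x (F y x 0 i)%:E)%E \is a fin_num.
  by apply: integrable_fin_num => //; exact: coord_integrable (mF y) (FL y).
rewrite /Rintegral.
apply: fine_cvg; rewrite fineK //.
Qed.

Lemma dot_mean_ge (L : R) m m' b : measurable_coords m -> (forall x, `|m x| <= L) ->
  measurable_coords m' -> (forall x, `|m' x| <= L) ->
  (forall x, dot (m x) b <= dot (m' x) b) -> dot (mean m) b <= dot (mean m') b.
Proof.
move=> mm mL mm' mL' mm'b; rewrite (dot_mean _ mm mL) (dot_mean _ mm' mL').
by apply: le_Rintegral => //; exact: dot_integrable.
Qed.

(** The difference of the two components is nonnegative with integral at most 0, so it vanishes
    almost everywhere. *)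
Lemma dot_mean_eq (L : R) m m' b : measurable_coords m -> (forall x, `|m x| <= L) ->
  measurable_coords m' -> (forall x, `|m' x| <= L) ->
  (forall x, dot (m x) b <= dot (m' x) b) -> dot (mean m') b <= dot (mean m) b ->
  \forall x \ae P, dot (m' x) b = dot (m x) b.
Proof.
move=> mm mL mm' mL' mm'b.
rewrite (dot_mean _ mm mL) (dot_mean _ mm' mL') => h.
pose f x := dot (m' x) b - dot (m x) b.
have mf : measurable_fun setT f by apply: measurable_funB; exact: measurable_dot.
have i1 := dot_integrable b mm mL.
have i2 := dot_integrable b mm' mL'.
have f0 x : 0 <= f x by rewrite subr_ge0.
have iF : P.-integrable setT (EFin \o f).
  rewrite (_ : _ \o _ = (EFin \o (fun x => dot (m' x) b)) \- (EFin \o (fun x => dot (m x) b)))%E //.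
  exact: integrableB.
have : (\int[P]_x (EFin \o f) x = 0)%E.
  rewrite -[LHS]fineK; last exact: integrable_fin_num.
  have -> : fine (\int[P]_x (EFin \o f) x)%E = (\int[P]_x f x)%R by [].
  rewrite RintegralB //; congr (_%:E); apply/eqP; rewrite eq_le subr_le0 h subr_ge0.
  exact: le_Rintegral.
have -> : (\int[P]_x (EFin \o f) x = \int[P]_x `|(EFin \o f) x|)%E.
  by apply: eq_integral => x _; rewrite /= ger0_norm.
have mEf : measurable_fun setT (EFin \o f) by exact/measurable_EFinP.
move=> /(ae_eq_integral_abs P measurableT mEf).
apply: filterS => x /= /(_ I) [] /eqP; rewrite subr_eq0 => /eqP -> //.
Qed.

End Mean.

Lemma ae_nonempty (R : realType) (d : measure_display) (T : measurableType d)
    (P : probability T R) (Q : T -> Prop) :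
  (\forall x \ae P, Q x) -> exists x, Q x.
Proof.
move=> [N [mN N0 QN]]; apply: contrapT => /forallNP nQ.
have NT : N = setT by rewrite -subTset => x _; exact/QN/nQ.
move: N0; rewrite NT (@probability_setT _ _ _ P) => /eqP.
by rewrite eqe oner_eq0.
Qed.

Lemma ae_forall_countable (R : realType) (d : measure_display) (T : measurableType d)
    (P : probability T R) (I : countType) (Q : I -> T -> Prop) :
  (forall i, \forall x \ae P, Q i x) -> \forall x \ae P, forall i, Q i x.
Proof.
move=> aeQ.
have : \forall x \ae P, forall k, if unpickle k is Some i then Q i x else True.
  apply: ae_foralln => k; case: (unpickle k) => [i|]; first exact: aeQ.
  exact: aeW.
by apply: filterS => x h i; have := h (pickle i); rewrite pickleK.
Qed.

(** * Monotone actions of a vector group on a probability space *)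

Section AbstractAction.
Variables (R : realType) (d : measure_display) (T : measurableType d).
Variables (P : probability T R) (n : nat) (m : T -> 'rV[R]_n).
Variables (tau : 'rV[R]_n -> T -> T) (L : R).
(** These hypotheses isolate what the geometry provides: [tau_mono] and [tau_strict] express that
    [tau] moves points along gradient flows, [tau_asym] that the measure is concentrated on the open
    unstable manifolds, and [tau_free] that its isotropy group is trivial. *)
Hypothesis mL : forall x, `|m x| <= L.
Hypothesis mm : forall y, measurable_coords (fun x => m (tau y x)).
Hypothesis cm : forall x, continuous (fun y => m (tau y x)).
Hypothesis tau0 : forall x, tau 0 x = x.
Hypothesis tauD : forall y z x, tau (y + z) x = tau y (tau z x).
Hypothesis tau_mono : forall y x, dot (m x) y <= dot (m (tau y x)) y.
Hypothesis tau_strict : forall y x, dot (m (tau y x)) y = dot (m x) y -> tau y x = x.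
Hypothesis tau_asym : forall b, \forall x \ae P, forall x' e, 0 < e ->
  \forall s \near +oo, dot (m x') b - e <= dot (m (tau (s *: b) x)) b.
Hypothesis tau_free : forall y, (\forall x \ae P, tau y x = x) -> y = 0.

(** Since [tau y] is [tau (y - z)] after [tau z], monotonicity along flow lines becomes monotonicity
    of [m] along a whole orbit. *)
Let mono y z x : 0 <= dot (m (tau y x) - m (tau z x)) (y - z).
Proof. by rewrite dotBl subr_ge0 -{2}(subrK z y) tauD tau_mono. Qed.

Let mono_dir b s t x : s <= t ->
  dot (m (tau (s *: b) x)) b <= dot (m (tau (t *: b) x)) b.
Proof.
rewrite le_eqVlt => /predU1P[->//|st].
have := mono (t *: b) (s *: b) x.
by rewrite -scalerBl dotZr pmulr_rge0 ?subr_gt0 // dotBl subr_ge0.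
Qed.

Let meanT y := mean P (fun x => m (tau y x)).

(** A single point that is generic for all rational directions suffices: its orbit alone already
    reaches every [xi]. *)
Let supported_range xi : supported m xi -> exists x, m x = xi.
Proof.
have [x xP] := ae_nonempty
  (ae_forall_countable (fun q : 'rV[rat]_n => tau_asym (map_mx ratr q))).
move=> sxi; have [] := @monotone_surj _ _ _ m L (fun y => m (tau y x)) xi => //.
by move=> y <-; exists (tau y x).
Qed.

Let supported_mean xi : supported m xi -> exists y, meanT y = xi.
Proof.
move=> sxi; apply: (@monotone_surj _ _ _ m `|L| meanT xi) => //.
- exact (@mean_continuous _ _ _ P _ _ L _ mm (fun y x => mL (tau y x)) cm).
- move=> y z; rewrite dotBl subr_ge0.
  apply: (@dot_mean_ge _ _ _ P _ L) => // x.
  by rewrite -subr_ge0 -dotBl; exact: mono.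
- by move=> y; exact: norm_mean.
(* Truncation at the limiting value makes dominated convergence applicable. *)
move=> q x' e e0; set b := map_mx ratr q; pose c := dot (m x') b - e / 2.
pose g s x := dot (m (tau (s *: b) x)) b.
have gL s x : `|g s x| <= n%:R * L * `|b|.
  by apply: le_trans (dot_le_norm _ _) _; rewrite ler_wpM2r // ler_wpM2l.
have mg s : measurable_fun setT (g s) by exact: measurable_dot.
pose f k x := Order.min (g k%:R x) c.
have mf k : measurable_fun setT (f k) by apply: measurable_minr.
have fL k x : `|f k x| <= n%:R * L * `|b| + `|c|.
  rewrite /f /Order.min; case: ifP => _; last by rewrite lerDr (le_trans _ (gL 0 x)).
  by rewrite (le_trans (gL _ _)) // lerDl.
have [||||| _ _ H] := @dominated_convergence _ _ _ P setT measurableT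
  (fun k x => (f k x)%:E) (fun x => c%:E) (fun=> (n%:R * L * `|b| + `|c|)%:E).
- by move=> j; exact/measurable_EFinP.
- exact: measurable_cst.
- have := tau_asym b; apply: filterS => x /(_ x' (e / 2)) H _.
  have e20 : 0 < e / 2 by lra.
  have [s0 [_ s0P]] := H e20.
  apply: cvg_near_cst; near=> k.
  congr (_%:E); rewrite /f; apply/min_idPr; apply: s0P.
  near: k; exact: nbhs_infty_gtr.
- apply: (@bounded_integrable _ _ _ P `|n%:R * L * `|b| + `|c| | (cst _)) => //.
- by apply: aeW => x j _; rewrite lee_fin.
have iF k : P.-integrable setT (EFin \o f k) by exact: bounded_integrable (mf k) (fL k).
have iG s : P.-integrable setT (EFin \o g s) by exact: bounded_integrable (mg s) (gL s).
have H2 : (\int[P]_x f k x)%R @[k --> \oo] --> c.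
  rewrite /Rintegral; apply: fine_cvg.
  by rewrite integral_const in H.
have e20 : 0 < e / 2 by lra.
have /cvgrPdist_lt /(_ _ e20) [N _ /(_ N (leqnn N))] := H2 => NP.
near=> s.
rewrite (@dot_mean _ _ _ P _ L) //.
apply: (@le_trans _ _ (\int[P]_x f N x)%R).
  move: NP; rewrite ltr_norml /c => /andP[_ h]. lra.
(* Dominated convergence supplies one integer time [N]; monotonicity in time extends the bound to
   all real [s] beyond it. *)
have Ns : N%:R <= s by near: s; exact: nbhs_pinfty_ge.
apply: le_Rintegral => //; first exact (iG s).
by move=> x _; apply: le_trans (mono_dir b x Ns); rewrite /f ge_min lexx.
Unshelve. all: by end_near.
Qed.

Let mean_supported y : supported m (meanT y).
Proof.
move=> b b0; apply: contrapT => /forallNP H.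
have Hle x : dot (m x) b <= dot (meanT y) b by rewrite leNgt; apply/negP.
(* Flowing by [b] can only raise the component along [b], yet by [Hle] its mean after the flow is at
   most the mean [meanT y] before it; so the two agree almost everywhere. *)
have : \forall x \ae P, dot (m (tau (b + y) x)) b = dot (m (tau y x)) b.
  apply: (@dot_mean_eq _ _ _ P _ L) => //.
    by move=> x; rewrite tauD tau_mono.
  rewrite (@dot_mean _ _ _ P _ L) //.
  rewrite -[leRHS](@Rintegral_const _ _ _ P); apply: le_Rintegral => //.
    exact: dot_integrable.
  by apply: (@bounded_integrable _ _ _ P `|dot (meanT y) b| (cst _)).
move=> H2; move/eqP: b0; apply; apply: tau_free; move: H2; apply: filterS => x.
rewrite tauD => /tau_strict h.
(* Applying [tau (- y)] turns the fixed point [tau y x] of [tau b] into the fixed point [x], because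
   the flows commute. *)
have : tau (- y) (tau b (tau y x)) = tau (- y) (tau y x) by rewrite h.
by rewrite -!tauD addrAC addNr add0r tau0.
Qed.

Lemma range_mean_interior :
  [set mean P (fun x => m (tau y x)) | y in [set: 'rV[R]_n]]
  = [set v | \forall w \near v, exists x, m x = w].
Proof.
rewrite (near_interior_supported supported_range); apply/seteqP; split.
  by move=> _ [y _ <-]; exact: mean_supported.
by move=> xi /supported_mean[y <-]; exists y.
Qed.

End AbstractAction.

(** * Curves in manifolds and Lie groups *)

Section CurveCalculus.
Variable R : realType.

Lemma is_derive_curve_comp (V W : normedModType R) (F : V -> W) (alpha : R -> V) (s : R) (v : V) :
  is_derive s 1 alpha v -> differentiable F (alpha s) ->
  is_derive s 1 (F \o alpha) ('d F (alpha s) v).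
Proof.
move=> da dF.
have dfa : differentiable alpha s by apply/derivable1_diffP; case: da.
have dFa : differentiable (F \o alpha) s by exact: differentiable_comp.
split; first exact: diff_derivable.
rewrite deriveE // diff_comp //=; congr ('d F _ _).
by rewrite -deriveE //; case: da.
Qed.

Lemma is_derive_linear n (W : normedModType R) (F : {linear 'rV[R]_n -> W})
    (alpha : R -> 'rV[R]_n) (s : R) v :
  is_derive s 1 alpha v -> is_derive s 1 (F \o alpha) (F v).
Proof.
move=> da.
have := is_derive_curve_comp da (linear_differentiable (f := F) (alpha s) (@linear_rV_continuous _ _ _ F)).
by rewrite diff_lin //; exact: linear_rV_continuous.
Qed.

Lemma is_derive_row_mx m n (a : R -> 'rV[R]_m) (b : R -> 'rV[R]_n) (s : R) v w :
  is_derive s 1 a v -> is_derive s 1 b w ->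
  is_derive s 1 (fun t => row_mx (a t) (b t)) (row_mx v w).
Proof.
move=> da db.
have E (x : 'rV[R]_m) (y : 'rV[R]_n) :
    row_mx x y = mulmxr (row_mx 1%:M 0) x + mulmxr (row_mx 0 1%:M) y.
  by rewrite /= !mul_mx_row !mulmx1 !mulmx0 add_row_mx addr0 add0r.
rewrite E; under eq_fun do rewrite E.
by apply: is_deriveD; apply: is_derive_linear.
Qed.

Lemma chart_curve_comp (T S : topologicalType) n m (c : chart R T n)
    (d : chart R S m) (f : T -> S) (alpha : R -> T) (s : R) v :
  open (dom c) -> (forall z, dom c z -> param c (coord c z) = z) ->
  {for s, continuous alpha} -> dom c (alpha s) ->
  differentiable (local_rep c d f) (coord c (alpha s)) ->
  is_derive s 1 (coord c \o alpha) v ->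
  is_derive s 1 (coord d \o (f \o alpha))
    ('d (local_rep c d f) (coord c (alpha s)) v).
Proof.
move=> oc cK ca cs df da.
apply: (@near_eq_is_derive _ _ _ (local_rep c d f \o (coord c \o alpha))).
- near=> t; rewrite /local_rep /= cK //.
  near: t; apply: ca; exact: open_nbhs_nbhs.
- exact: is_derive_curve_comp.
Unshelve. all: by end_near.
Qed.

Lemma smooth_map_differentiable (T S : topologicalType) n m (A : set (chart R T n))
    (A' : set (chart R S m)) (f : T -> S) c d z :
  smooth_map A A' f -> A c -> A' d -> dom c z -> dom d (f z) ->
  differentiable (local_rep c d f) (coord c z).
Proof.
move=> [_ sf] Ac Ad cz dz.
have [+ _] := sf c d Ac Ad 1; apply; exists z => //.
Qed.

(** Common source of the product rule for group multiplication and for the action: the pair of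
    curves is read in a product chart. *)
Lemma prod_curve_comp (T S X : topologicalType) n m k (A : set (chart R T n))
    (A' : set (chart R S m)) (A'' : set (chart R X k)) (f : T * S -> X)
    (c : chart R T n) (c' : chart R S m) (d : chart R X k)
    (alpha : R -> T) (beta : R -> S) (s : R) v w :
  smooth_map (prod_atlas A A') A'' f -> A c -> A' c' -> A'' d ->
  is_chart c -> is_chart c' ->
  {for s, continuous alpha} -> {for s, continuous beta} ->
  dom c (alpha s) -> dom c' (beta s) -> dom d (f (alpha s, beta s)) ->
  is_derive s 1 (coord c \o alpha) v -> is_derive s 1 (coord c' \o beta) w ->
  is_derive s 1 (coord d \o (fun t => f (alpha t, beta t)))
    ('d (local_rep (prod_chart c c') d f)
       (row_mx (coord c (alpha s)) (coord c' (beta s))) (row_mx v w)).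
Proof.
move=> sf Ac Ac' Ad hc hc' ca cb cs cs' ds da db.
have := @chart_curve_comp _ _ _ _ (prod_chart c c') d f (fun t => (alpha t, beta t)) s (row_mx v w).
apply => //.
- rewrite openE => -[x y] [/= cx cy]; exists (dom c, dom c') => //=.
  by split; apply: open_nbhs_nbhs; split => //; exact: open_dom.
- by move=> [x y] /= [cx cy]; rewrite row_mxKl row_mxKr !coordK.
- exact (cvg_pair ca cb).
- apply: (@smooth_map_differentiable _ _ _ _ (prod_atlas A A') A'' f (prod_chart c c') d (alpha s, beta s)) => //.
  by exists c, c'.
- exact: is_derive_row_mx.
Qed.

End CurveCalculus.

Section ZeroVelocity.
Variable R : realType.

Lemma is_derive_coord n (f : R -> 'rV[R]_n) (s : R) v i :
  is_derive s 1 f v -> is_derive s 1 (fun t => f t 0 i) (v 0 i).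
Proof.
move=> [df fv]; split; first by have /derivable_mxP := df; apply.
by rewrite -fv derive_mx // mxE.
Qed.

Lemma is_derive0_segment (f : R -> R) (a b : R) :
  a <= b -> (forall x, x \in `[a, b] -> is_derive x 1 f 0) -> f a = f b.
Proof.
move=> ab df.
have cf : {within `[a, b], continuous f}.
  by apply: derivable_within_continuous => x xab; have [] := df x xab.
have dfo x : x \in `]a, b[ -> is_derive x 1 f ((fun=> 0) x).
  by move=> xab; apply: df; exact: subset_itv_oo_cc.
have [x _] := MVT_segment ab dfo cf.
by rewrite mul0r => /eqP; rewrite subr_eq0 => /eqP.
Qed.

(** The times at which [alpha] has its initial value form a closed set, by the Hausdorff property,
    and an open one, because inside a chart each coordinate has zero derivative along a segment. The
    real line is connected. *)
Lemma zero_velocity_const (T : topologicalType) n (J : 'M[R]_n)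
    (A : set (chart R T n)) (alpha : R -> T) :
  is_complex_manifold J A -> continuous alpha ->
  (forall s c, A c -> dom c (alpha s) -> is_derive s 1 (coord c \o alpha) 0) ->
  forall s, alpha s = alpha 0.
Proof.
move=> hT ca da s.
pose B := [set t | alpha t = alpha 0].
suff : B = setT by move=> BT; have : [set: R] s by []; rewrite -BT.
have cR : connected [set: R] by apply/connected_intervalP => x y _ _ z _.
apply: cR.
- by exists 0.
- exists B; last by rewrite setTI.
  rewrite openE => t Bt.
  have [c Ac ct] := atlas_cover hT (alpha t).
  have hc := atlas_is_chart hT Ac.
  have /nbhs_ballP[e /= e0 eP] : nbhs t (alpha @^-1` dom c).
    by apply: ca; apply: open_nbhs_nbhs; split => //; exact: open_dom.
  apply/nbhs_ballP; exists e => //= t' tt'.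
  rewrite /B /= -Bt -(coordK hc (eP _ tt')) -(coordK hc ct); congr (param c _).
  have seg x : Order.min t t' <= x <= Order.max t t' -> ball t e x.
    move: tt'; rewrite /ball /= !ltr_distl => /andP[h1 h2] /andP[].
    by rewrite ge_min le_max => /orP[]h3 /orP[]h4; apply/andP; split; lra.
  apply/rowP => i.
  have D x : Order.min t t' <= x <= Order.max t t' ->
      is_derive x 1 (fun t => coord c (alpha t) 0 i) 0.
    move=> /seg /eP xc.
    have := is_derive_coord i (da x c Ac xc); rewrite mxE; exact.
  have [tt|tt] := leP t t'.
    symmetry; apply: (@is_derive0_segment (fun r => coord c (alpha r) 0 i)) => // x; rewrite in_itv /= => xtt.
    by apply: D; rewrite min_l // max_r.
  apply: (@is_derive0_segment (fun r => coord c (alpha r) 0 i)); first exact: ltW.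
  move=> x; rewrite in_itv /= => xtt.
  by apply: D; rewrite min_r ?max_l // ltW.
- exists B; last by rewrite setTI.
  have -> : B = alpha @^-1` [set alpha 0] by [].
  apply: preimage_closed; first by move=> ? _; exact: ca.
  exact/accessible_closed_set1/hausdorff_accessible/(manifold_hausdorff hT).
Qed.

End ZeroVelocity.

(** * One-parameter subgroups and their uniqueness *)

Section LieGroupCurves.
Variable R : realType.

Lemma is_derive_affine (V : normedModType R) (F : R -> V) (k c s : R) (v : V) :
  is_derive (k * s + c) 1 F v -> is_derive s 1 (fun t => F (k * t + c)) (k *: v).
Proof.
move=> dF.
have da : is_derive s (1 : R) (fun t : R => k * t + c) k.
  have -> : (fun t : R => k * t + c) = (k *: (@id R)) + cst c by [].
  by apply: is_derive_eq; rewrite addr0 [_ *: _]mulr1.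
have dFs : differentiable F (k * s + c) by apply/derivable1_diffP; case: dF.
have := is_derive_curve_comp da dFs.
by rewrite diff1E // derive1E; case: dF => _ ->.
Qed.

Variable UC : complexLieGroup R.
Local Notation k := (lg_dim UC).
Local Notation exp := (@lg_exp R UC).
Local Notation c1 := (lg_chart1 UC).
Local Notation atl := (@lg_atlas R UC).
Local Open Scope group_scope.

Lemma lg_is_chart c : atl c -> is_chart c.
Proof. by move=> Ac; exact (atlas_is_chart (lg_manifold UC) Ac). Qed.

Lemma lg_cover (g : UC) : exists2 c, atl c & dom c g.
Proof. exact (atlas_cover (lg_manifold UC) g). Qed.

Lemma mul_continuous : continuous (fun x : UC * UC => x.1 * x.2).
Proof. exact: (lg_mul UC).1.1. Qed.

Lemma curve_mul_continuous (T : topologicalType) (a b : T -> UC) :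
  continuous a -> continuous b -> continuous (fun t => a t * b t).
Proof.
move=> ca cb t.
exact (continuous_comp (cvg_pair (ca t) (cb t)) (@mul_continuous (a t, b t))).
Qed.

Definition mul_rep (c c' d : chart R UC k) :=
  local_rep (prod_chart c c') d (fun x : UC * UC => x.1 * x.2).

Lemma mul_curve (c c' d : chart R UC k) (a b : R -> UC) (s : R) v w :
  atl c -> atl c' -> atl d ->
  {for s, continuous a} -> {for s, continuous b} ->
  dom c (a s) -> dom c' (b s) -> dom d (a s * b s) ->
  is_derive s 1%R (coord c \o a) v -> is_derive s 1%R (coord c' \o b) w ->
  is_derive s 1%R (coord d \o (fun t => a t * b t))
    ('d (mul_rep c c' d) (row_mx (coord c (a s)) (coord c' (b s))) (row_mx v w)).
Proof.
move=> Ac Ac' Ad ca cb cs cs' ds da db.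
exact (@prod_curve_comp R _ _ _ _ _ _ _ _ _ (fun x : UC * UC => x.1 * x.2) c c' d a b s v w
  (lg_mul UC).1 Ac Ac' Ad (lg_is_chart Ac) (lg_is_chart Ac') ca cb cs cs' ds da db).
Qed.

Lemma cst_velocity (e : chart R UC k) (x : UC) (s : R) :
  is_derive s (1%R : R) (coord e \o cst x) 0%R.
Proof. exact (is_derive_cst (coord e x) s (1%R : R)). Qed.

Lemma cst_continuous_at (x : UC) (s : R) : {for s, continuous (cst x : R -> UC)}.
Proof. exact: cvg_cst. Qed.

(** Whatever the differentials of the two translations are, they are linear and so send velocity 0
    to 0. *)
Lemma translate_zero_velocity (c d : chart R UC k) (a : R -> UC) (s : R) g h :
  atl c -> atl d -> {for s, continuous a} -> dom c (a s) -> dom d (g * a s * h) ->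
  is_derive s 1%R (coord c \o a) 0%R ->
  is_derive s 1%R (coord d \o (fun t => g * a t * h)) 0%R.
Proof.
move=> Ac Ad ca cs ds da.
have [cg Acg cgg] := lg_cover g; have [ch Ach chh] := lg_cover h.
have [c2 Ac2 c2g] := lg_cover (g * a s).
have := mul_curve Acg Ac Ac2 (@cst_continuous_at g s) ca cgg cs c2g (cst_velocity cg g s) da.
rewrite row_mx0 linear0 => d1.
have c1' : {for s, continuous (fun t => g * a t)}.
  exact (continuous_comp (cvg_pair (@cst_continuous_at g s) ca) (@mul_continuous (g, a s))).
have := mul_curve Ac2 Ach Ad c1' (@cst_continuous_at h s) c2g chh ds d1 (cst_velocity ch h s).
by rewrite row_mx0 linear0.
Qed.

(** The characterisation of [lg_exp], made available for other curves such as conjugates and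
    products of exponentials. *)
Definition one_param (gamma : R -> UC) (v : 'rV[R]_k) :=
  [/\ forall s t : R, gamma (s + t)%R = gamma s * gamma t, continuous gamma &
      is_derive (0%R : R) 1%R (coord c1 \o gamma) v].

Lemma one_param0 gamma v : one_param gamma v -> gamma 0%R = 1.
Proof.
move=> [gD _ _]; apply: (@mulgI _ (gamma 0%R)).
by rewrite -gD addr0 mulg1.
Qed.

Lemma one_paramN gamma v s : one_param gamma v -> gamma (- s)%R = (gamma s)^-1.
Proof.
move=> og; have [gD _ _] := og; apply: (@mulgI _ (gamma s)).
by rewrite -gD subrr (one_param0 og) mulgV.
Qed.

Lemma exp_one_param (v : 'rV[R]_k) : one_param (fun t : R => exp (t *: v)%R) v.
Proof. by have [] := lg_expP v. Qed.

Lemma lg_exp0 : exp 0%R = 1.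
Proof. by rewrite -(one_param0 (exp_one_param 0)) scale0r. Qed.

(** By linearity each factor can be treated alone, along the curves (exp (t v), 1) and (1, exp (t
    w)), whose products are the exponentials themselves. *)
Lemma diff_mul1 (v w : 'rV[R]_k) :
  'd (mul_rep c1 c1 c1) (row_mx (coord c1 1) (coord c1 1)) (row_mx v w) = (v + w)%R.
Proof.
have A1 := lg_chart1_atlas UC; have D1 := lg_chart1_dom UC.
have -> : row_mx v w = (row_mx v 0 + row_mx 0 w)%R.
  by rewrite add_row_mx addr0 add0r.
have [gD cg dg] := exp_one_param v; have g0 := one_param0 (exp_one_param v).
have [hD ch dh] := exp_one_param w; have h0 := one_param0 (exp_one_param w).
rewrite linearD; congr (_ + _)%R.
  have := @mul_curve c1 c1 c1 _ _ _ _ _ A1 A1 A1 (cg 0%R) (@cst_continuous_at 1 0%R) _ _ _ dg (cst_velocity c1 1 0%R).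
  rewrite /= g0 mulg1 => /(_ D1 D1 D1) [_ <-].
  under eq_fun do rewrite /= mulg1.
  by case: dg.
have := @mul_curve c1 c1 c1 _ _ _ _ _ A1 A1 A1 (@cst_continuous_at 1 0%R) (ch 0%R) _ _ _ (cst_velocity c1 1 0%R) dh.
rewrite /= h0 mulg1 => /(_ D1 D1 D1) [_ <-].
under eq_fun do rewrite /= mul1g.
by case: dh.
Qed.

Lemma one_param_mul_velocity gamma eta v w :
  one_param gamma v -> one_param eta w ->
  is_derive (0%R : R) 1%R (coord c1 \o (fun t => gamma t * eta t)) (v + w)%R.
Proof.
move=> og oh; have [_ cg dg] := og; have [_ ch dh] := oh.
have A1 := lg_chart1_atlas UC; have D1 := lg_chart1_dom UC.
have := mul_curve A1 A1 A1 (cg 0%R) (ch 0%R) _ _ _ dg dh.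
rewrite (one_param0 og) (one_param0 oh) mulg1 diff_mul1; exact.
Qed.

Lemma one_param_scale gamma v (r : R) :
  one_param gamma v -> one_param (fun t => gamma (r * t)%R) (r *: v)%R.
Proof.
move=> [gD cg dg]; split.
- by move=> s t; rewrite mulrDr gD.
- exact (continuousT_comp (@mulrl_continuous _ r) cg).
- have := @is_derive_affine _ (coord c1 \o gamma) r 0%R 0%R v.
  rewrite mulr0 addr0 => /(_ dg).
  by under eq_fun do rewrite addr0.
Qed.

(** The curve alpha s = gamma s * eta (- s) has velocity v - v = 0 at time 0. The identity alpha t =
    gamma s * alpha (t - s) * eta (- s) transports this to every time [s], so [alpha] is constantly
    1. *)
Lemma one_param_unique gamma eta v :
  one_param gamma v -> one_param eta v -> gamma = eta.
Proof.
move=> og oh; have [gD cg dg] := og; have [hD ch dh] := oh.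
have ohN := one_param_scale (-1) oh.
pose alpha s := gamma s * eta (-1 * s)%R.
have calpha : continuous alpha.
  by have [_ chN _] := ohN; exact: curve_mul_continuous.
have da0 : is_derive (0%R : R) 1%R (coord c1 \o alpha) 0%R.
  have := one_param_mul_velocity og ohN.
  by rewrite scaleN1r subrr.
have aS s t : alpha t = gamma s * alpha (t - s)%R * eta (-1 * s)%R.
  have E1 : gamma t = gamma s * gamma (t - s)%R by rewrite -gD subrKC.
  have E2 : eta (-1 * t)%R = eta (-1 * (t - s))%R * eta (-1 * s)%R.
    by rewrite -hD -mulrDr subrK.
  by rewrite /alpha E1 E2 !mulgA.
have A1 := lg_chart1_atlas UC; have D1 := lg_chart1_dom UC.
have a0 : alpha 0%R = 1 by rewrite /alpha (one_param0 og) (one_param0 ohN) mulg1.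
have az s c : atl c -> dom c (alpha s) -> is_derive s 1%R (coord c \o alpha) 0%R.
  move=> Ac cs.
  have -> : coord c \o alpha = fun t => (coord c \o (fun t => gamma s * alpha t * eta (-1 * s)%R)) (1 * t + - s)%R.
    by apply/funext => t /=; rewrite mul1r -aS.
  rewrite -[X in is_derive _ _ _ X](scaler0 _ 1%R).
  apply: is_derive_affine; rewrite mul1r subrr.
  apply: (@translate_zero_velocity c1) => //; first exact: calpha.
    by rewrite a0.
  by rewrite -(subrr s) -aS.
apply/funext => s.
have := zero_velocity_const (lg_manifold UC) calpha az s.
rewrite a0 /alpha mulN1r (one_paramN _ oh) => h.
by apply: (@mulIg _ (eta s)^-1); rewrite mulgV.
Qed.

End LieGroupCurves.

Lemma linear_row_mx0 (R : realType) m n (V : lmodType R)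
  (f : {linear 'rV[R]_(m + n) -> V}) : linear (fun u => f (row_mx u 0)).
Proof.
move=> a u v; rewrite -linearP; congr (f _).
by rewrite scale_row_mx add_row_mx scaler0 addr0.
Qed.

Lemma linear_row_0mx (R : realType) m n (V : lmodType R)
  (f : {linear 'rV[R]_(m + n) -> V}) : linear (fun u => f (row_mx 0 u)).
Proof.
move=> a u v; rewrite -linearP; congr (f _).
by rewrite scale_row_mx add_row_mx scaler0 addr0.
Qed.

(** * Complex linearity and multiplicativity of the adjoint action *)

Section AdjointAction.
Variable R : realType.
Variable UC : complexLieGroup R.
Local Notation k := (lg_dim UC).
Local Notation exp := (@lg_exp R UC).
Local Notation c1 := (lg_chart1 UC).
Local Notation atl := (@lg_atlas R UC).
Local Notation J := (lg_J UC).
Local Open Scope group_scope.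

Lemma mul_rep_differentiable (c c' d : chart R UC k) x y :
  atl c -> atl c' -> atl d -> dom c x -> dom c' y -> dom d (x * y) ->
  differentiable (mul_rep c c' d) (row_mx (coord c x) (coord c' y)).
Proof.
move=> Ac Ac' Ad cx cy dxy.
apply: (@smooth_map_differentiable _ _ _ _ _ (prod_atlas atl atl) atl
  (fun x : UC * UC => x.1 * x.2) (prod_chart c c') d (x, y) (lg_mul UC).1) => //.
by exists c, c'.
Qed.

Lemma diff_mul_J (c c' d : chart R UC k) x y (v w : 'rV[R]_k) :
  atl c -> atl c' -> atl d -> dom c x -> dom c' y -> dom d (x * y) ->
  'd (mul_rep c c' d) (row_mx (coord c x) (coord c' y)) (row_mx (v *m J) (w *m J))
  = ('d (mul_rep c c' d) (row_mx (coord c x) (coord c' y)) (row_mx v w) *m J)%R.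
Proof.
move=> Ac Ac' Ad cx cy dxy.
have df := mul_rep_differentiable Ac Ac' Ad cx cy dxy.
have [_ hol] := lg_mul UC.
have := hol (prod_chart c c') d _ Ad (row_mx (coord c x) (coord c' y)) _ (row_mx v w).
rewrite /prod_J mul_row_block !mulmx0 addr0 add0r !deriveE //; apply.
  by exists c, c'.
by exists (x, y).
Qed.

(** Conjugation is a left followed by a right multiplication, so its velocity is a composite of two
    partial differentials of the product. These are linear, and commute with [J] because
    multiplication is holomorphic. *)
Lemma conj_velocity (g : UC) : exists F : 'rV[R]_k -> 'rV[R]_k,
  [/\ linear F, forall v, F (v *m J)%R = (F v *m J)%R &
   forall v, is_derive (0%R : R) 1%R (coord c1 \o (fun t : R => g * exp (t *: v)%R * g^-1)) (F v)].
Proof.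
have A1 := lg_chart1_atlas UC; have D1 := lg_chart1_dom UC.
have [cg Acg cgg] := lg_cover g; have [ch Ach chh] := lg_cover g^-1.
pose F1 w := 'd (mul_rep cg c1 cg) (row_mx (coord cg g) (coord c1 1)) (row_mx 0 w).
pose F2 u := 'd (mul_rep cg ch c1) (row_mx (coord cg g) (coord ch g^-1)) (row_mx u 0).
exists (F2 \o F1); split.
- have lF1 : linear F1 by exact: linear_row_0mx.
  have lF2 : linear F2 by exact: linear_row_mx0.
  by move=> a u v; rewrite /= lF1 lF2.
- have dg1 : dom cg (g * 1) by rewrite mulg1.
  have dg2 : dom c1 (g * g^-1) by rewrite mulgV.
  have JF1 v : F1 (v *m J)%R = (F1 v *m J)%R.
    have := diff_mul_J 0%R v Acg A1 Acg cgg D1 dg1.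
    by rewrite [X in row_mx X (v *m J)](mul0mx _ J).
  have JF2 v : F2 (v *m J)%R = (F2 v *m J)%R.
    have := diff_mul_J v 0%R Acg Ach A1 cgg chh dg2.
    by rewrite [X in row_mx (v *m J) X](mul0mx _ J).
  by move=> v; rewrite /comp JF1 JF2.
- move=> v; have [gD cv dv] := exp_one_param v; have e0 := one_param0 (exp_one_param v).
  have d1 : is_derive (0%R : R) 1%R (coord cg \o (fun t : R => g * exp (t *: v)%R)) (F1 v).
    have := mul_curve Acg A1 Acg (@cst_continuous_at _ _ g 0%R) (cv 0%R) _ _ _ (cst_velocity cg g 0%R) dv.
    by rewrite /= e0 mulg1; apply.
  have cgv : {for (0%R : R), continuous (fun t : R => g * exp (t *: v)%R)}.
    by apply: curve_mul_continuous => // t; exact: cvg_cst.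
  have := mul_curve Acg Ach A1 cgv (@cst_continuous_at _ _ g^-1 0%R) _ _ _ d1 (cst_velocity ch g^-1 0%R).
  by rewrite /= e0 mulg1 mulgV; apply.
Qed.

Lemma Ad_velocity (g : UC) v :
  is_derive (0%R : R) 1%R (coord c1 \o (fun t : R => g * exp (t *: v)%R * g^-1)) (Ad g v).
Proof.
have [F [_ _ dF]] := conj_velocity g.
by have [dv _] := dF v; split.
Qed.

Lemma AdE (g : UC) : exists F : 'rV[R]_k -> 'rV[R]_k,
  [/\ linear F, forall v, F (v *m J)%R = (F v *m J)%R & Ad g = F].
Proof.
have [F [lF JF dF]] := conj_velocity g; exists F; split => //.
by apply/funext => v; have [_ <-] := dF v.
Qed.

Lemma Ad_linear (g : UC) : linear (Ad g : 'rV[R]_k -> 'rV[R]_k).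
Proof. by have [F [lF _ ->]] := AdE g. Qed.

Lemma Ad_J (g : UC) (v : 'rV[R]_k) : Ad g (v *m J)%R = (Ad g v *m J)%R.
Proof. by have [F [_ JF ->]] := AdE g. Qed.

Lemma AdD (g : UC) (v w : 'rV[R]_k) : Ad g (v + w)%R = (Ad g v + Ad g w)%R.
Proof. by have := Ad_linear g 1%R v w; rewrite !scale1r. Qed.

Lemma Ad0 (g : UC) : Ad g 0%R = 0%R.
Proof. by apply: (@addrI _ (Ad g 0%R)); rewrite -AdD !addr0. Qed.

Lemma conj_one_param (g : UC) (v : 'rV[R]_k) : one_param (fun t : R => g * exp (t *: v)%R * g^-1) (Ad g v).
Proof.
have [gD cv _] := exp_one_param v; split; last exact: Ad_velocity.
- by move=> s t; rewrite gD -!mulgA; congr (_ * (_ * _)); rewrite mulKg.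
- apply: curve_mul_continuous; last by move=> t; exact: cvg_cst.
  by apply: curve_mul_continuous => // t; exact: cvg_cst.
Qed.

(** Both sides are one-parameter subgroups with velocity [Ad g v]. *)
Lemma exp_Ad (g : UC) v (t : R) : exp (t *: Ad g v)%R = g * exp (t *: v)%R * g^-1.
Proof.
by have := one_param_unique (exp_one_param (Ad g v)) (conj_one_param g v) => /(congr1 (@^~ t)).
Qed.

Lemma AdM (g h : UC) v : Ad (g * h) v = Ad g (Ad h v).
Proof.
rewrite [RHS]/Ad /velocity; under [in RHS]eq_fun do rewrite exp_Ad.
by rewrite /Ad /velocity; under eq_fun do rewrite invgM !mulgA; under [in RHS]eq_fun do rewrite !mulgA.
Qed.

Lemma Ad1 v : Ad (1 : UC) v = v.
Proof.
have [_ _ [_ dv]] := exp_one_param v; rewrite -[RHS]dv /Ad /velocity.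
by under eq_fun do rewrite mul1g invg1 mulg1.
Qed.

End AdjointAction.

Lemma alternating_antisym (V : zmodType) (b : V -> V -> V) :
  (forall v v' w, b (v + v') w = b v w + b v' w) ->
  (forall v w w', b v (w + w') = b v w + b v w') ->
  (forall v, b v v = 0) -> forall v w, b v w = - b w v.
Proof.
move=> bDl bDr bvv v w; have := bvv (v + w).
by rewrite bDl !bDr !bvv add0r addr0 => /eqP; rewrite addr_eq0 => /eqP.
Qed.

Lemma is_derive_inj (R : realType) (V : normedModType R) (f g : R -> V) (s : R) v w :
  is_derive s 1 f v -> is_derive s 1 g w -> f =1 g -> v = w.
Proof. by move=> [_ <-] [_ <-] /funext ->. Qed.

Lemma additive_coords (R : realType) k n (b : 'rV[R]_k -> 'rV[R]_n) :
  (forall l, exists2 f : {linear 'rV[R]_k -> R}, True & forall v, b v 0 l = f v) ->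
  forall v v', b (v + v') = b v + b v'.
Proof.
by move=> bl v v'; apply/rowP => l; have [f _ fE] := bl l; rewrite mxE !fE linearD.
Qed.

Lemma differentiable_sum_fun (R : realType) (V W : normedModType R) n
    (F : 'I_n -> V -> W) x :
  (forall i, differentiable (F i) x) ->
  differentiable (fun y => \sum_(i < n) F i y) x.
Proof.
move=> dF; have -> : (fun y => \sum_(i < n) F i y) = \sum_(i < n) F i.
  by apply/funext => y; rewrite fct_sumE.
exact: differentiable_sum.
Qed.

Lemma differentiable_coord_comp (R : realType) (V : normedModType R) n
    (G : V -> 'rV[R]_n) i x :
  differentiable G x -> differentiable (fun y => G y 0 i) x.
Proof.
move=> dG.
exact (differentiable_comp dG (@differentiable_coord R 1 n (G x) 0 i)).
Qed.

Lemma differentiable_row_mx (R : realType) (V : normedModType R) m n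
    (F : V -> 'rV[R]_m) (G : V -> 'rV[R]_n) x :
  differentiable F x -> differentiable G x ->
  differentiable (fun y => row_mx (F y) (G y)) x.
Proof.
move=> dF dG.
have E (y : 'rV[R]_m) (z : 'rV[R]_n) :
    row_mx y z = mulmxr (row_mx 1%:M 0) y + mulmxr (row_mx 0 1%:M) z.
  by rewrite /= !mul_mx_row !mulmx1 !mulmx0 add_row_mx addr0 add0r.
under eq_fun do rewrite E.
have L p (M : 'M[R]_(p, m + n)) y : differentiable (mulmxr M : 'rV[R]_p -> 'rV[R]_(m + n)) y.
  exact/linear_differentiable/linear_rV_continuous.
exact (differentiableD (differentiable_comp dF (L _ _ _)) (differentiable_comp dG (L _ _ _))).
Qed.

(** * Adjoint representation and bracket *)

Section Bracket.
Variable R : realType.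
Variable UC : complexLieGroup R.
Local Notation k := (lg_dim UC).
Local Notation exp := (@lg_exp R UC).
Local Notation c1 := (lg_chart1 UC).
Local Notation J := (lg_J UC).
Local Open Scope group_scope.

Lemma diff_delta n (V : normedModType R) (f : 'rV[R]_n -> V) y v :
  differentiable f y ->
  'd f y v = (\sum_i v 0%R i *: 'D_(delta_mx 0%R i) f y)%R.
Proof.
move=> df; rewrite {1}[v]row_sum_delta linear_sum.
by apply: eq_bigr => i _; rewrite linearZ deriveE.
Qed.

Let m := mul_rep c1 c1 c1.
Let inv_rep := local_rep c1 c1 (fun x : UC => x^-1).
Let e : 'rV[R]_k := coord c1 (1 : UC).
Let pd (i : 'I_(k + k)) y := 'D_(delta_mx 0%R i) m y.

Let A1 := lg_chart1_atlas UC.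
Let D1 := lg_chart1_dom UC.

(** Multiplication is of class C^2, so its first partial derivatives are again differentiable. *)
Let pd_differentiable i (x y : UC) : dom c1 x -> dom c1 y -> dom c1 (x * y) ->
  differentiable (pd i) (row_mx (coord c1 x) (coord c1 y)).
Proof.
move=> cx cy cxy.
have [_ /(_ (prod_chart c1 c1) c1 _ A1)] := (lg_mul UC).1.
move=> /(_ _)/wrap[|sm]; first by exists c1, c1.
have [_ /(_ i) [+ _]] := sm 2%N; apply.
by exists (x, y).
Qed.

Lemma Ad_near1 w l : exists2 F : 'rV[R]_k -> R, differentiable F e &
  \forall g \near (1 : UC), (Ad g w : 'rV[R]_k) 0%R l = F (coord c1 g).
Proof.
(* [F] is the chain rule for [t |-> g exp(t w) g^-1], written with the partial
   derivatives [pd] so that its dependence on [g] is visibly differentiable. *)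
pose F (x : 'rV[R]_k) : R := (\sum_(i < k)
  (\sum_(j < k) w 0 j * pd (rshift k j) (row_mx x e) 0 i) *
  pd (lshift k i) (row_mx x (inv_rep x)) 0 l)%R.
exists F.
  have De : dom c1 (1 * 1 : UC) by rewrite mulg1.
  have did : differentiable (id : 'rV[R]_k -> 'rV[R]_k) e by exact: ex_diff.
  have ide : inv_rep e = e.
    by rewrite /inv_rep /local_rep /= (coordK (lg_is_chart A1) D1) invg1.
  have invD : differentiable inv_rep e.
    by apply: (smooth_map_differentiable (lg_inv UC).1) => //; rewrite invg1.
  apply: differentiable_sum_fun => i; apply: differentiableM.
    apply: differentiable_sum_fun => j; apply: differentiableM.
      exact: differentiable_cst.
    apply: differentiable_coord_comp.
    have dr := differentiable_row_mx did (differentiable_cst e e).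
    exact (differentiable_comp dr (pd_differentiable (rshift k j) D1 D1 De)).
  apply: differentiable_coord_comp.
  have dr := differentiable_row_mx did invD.
  apply: (differentiable_comp dr).
  by rewrite ide; exact: pd_differentiable.
have n1 : \forall g \near (1 : UC), dom c1 g.
  by apply: open_nbhs_nbhs; split => //; exact: open_dom (lg_is_chart A1).
have n2 : \forall g \near (1 : UC), dom c1 g^-1.
  have ci : continuous (fun x : UC => x^-1) := (lg_inv UC).1.1.
  apply: (ci 1); rewrite invg1.
  by apply: open_nbhs_nbhs; split => //; exact: open_dom (lg_is_chart A1).
near=> g.
have gd : dom c1 g by near: g.
have gd' : dom c1 g^-1 by near: g.
have [gD cv dv] := exp_one_param w; have e0 := one_param0 (exp_one_param w).
have g1 : dom c1 (g * 1) by rewrite mulg1.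
have gv : dom c1 (g * g^-1) by rewrite mulgV.
have d1 : is_derive (0%R : R) 1%R (coord c1 \o (fun t : R => g * exp (t *: w)%R))
    ('d m (row_mx (coord c1 g) e) (row_mx 0%R w)).
  have := mul_curve A1 A1 A1 (@cst_continuous_at _ _ g 0%R) (cv 0%R) _ _ _ (cst_velocity c1 g 0%R) dv.
  by rewrite /= e0 mulg1; apply.
have cgv : {for (0%R : R), continuous (fun t : R => g * exp (t *: w)%R)}.
  by apply: curve_mul_continuous => // t; exact: cvg_cst.
have := mul_curve A1 A1 A1 cgv (@cst_continuous_at _ _ g^-1 0%R) _ _ _ d1 (cst_velocity c1 g^-1 0%R).
rewrite /= e0 mulg1 mulgV => /(_ gd gd' D1) [_ AdF].
rewrite [Ad g w]AdF /F.
have iE : inv_rep (coord c1 g) = coord c1 g^-1.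
  by rewrite /inv_rep /local_rep /= (coordK (lg_is_chart A1) gd).
rewrite iE diff_delta; last exact: mul_rep_differentiable.
rewrite summxE big_split_ord /= [X in (_ + X)%R]big1 ?addr0; last first.
  by move=> i _; rewrite mxE row_mxEr mxE mul0r.
apply: eq_bigr => i _; rewrite mxE row_mxEl; congr (_ * _)%R.
rewrite diff_delta; last exact: mul_rep_differentiable.
rewrite summxE big_split_ord /= [X in (X + _)%R]big1 ?add0r; last first.
  by move=> j _; rewrite mxE row_mxEl mxE mul0r.
by apply: eq_bigr => j _; rewrite mxE row_mxEr.
Unshelve. all: by end_near.
Qed.

(** Near 1 an entry of [Ad g w] is one fixed differentiable function of the coordinates of [g]. Its
    derivative along exp (t v) is therefore a differential applied to [v]; this yields additivity of
    the bracket in its first argument. *)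
Lemma Ad_exp_derive w l : exists2 f : {linear 'rV[R]_k -> R}, True &
  forall v, is_derive (0%R : R) 1%R (fun t : R => (Ad (exp (t *: v)%R) w : 'rV[R]_k) 0%R l) (f v).
Proof.
have [F dF FP] := Ad_near1 w l.
exists ('d F e) => // v.
have [gD cv dv] := exp_one_param v; have e0 := one_param0 (exp_one_param v).
pose f (t : R) : R := (Ad (exp (t *: v)%R) w : 'rV[R]_k) 0%R l.
pose h (t : R) : R := F (coord c1 (exp (t *: v)%R)).
have dh : is_derive (0%R : R) 1%R h ('d F e v).
  have := @is_derive_curve_comp _ _ _ F _ _ _ dv; rewrite /= e0; exact.
have hf : \forall t \near (0%R : R), h t = f t.
  rewrite -e0 in FP.
  have : \forall t \near (0%R : R), (Ad (exp (t *: v)%R) w : 'rV[R]_k) 0%R l = F (coord c1 (exp (t *: v)%R)).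
    exact (cv 0%R _ FP).
  by apply: filterS => t /esym.
exact (near_eq_is_derive hf dh).
Qed.

Lemma bracket_derive (v w : 'rV[R]_k) :
  is_derive (0%R : R) 1%R (fun t : R => Ad (exp (t *: v)%R) w) (bracket v w).
Proof.
apply/derivableP/derivable_mxP => i l; rewrite (ord1 i).
by have [f _ df] := Ad_exp_derive w l; have [] := df v.
Qed.

Lemma bracket_coord w l : exists2 f : {linear 'rV[R]_k -> R}, True &
  forall v, (bracket v w : 'rV[R]_k) 0%R l = f v.
Proof.
have [f _ df] := Ad_exp_derive w l; exists f => // v.
by have [_ <-] := is_derive_coord l (bracket_derive v w); have [_ ->] := df v.
Qed.

Lemma bracketDl (v v' w : 'rV[R]_k) :
  bracket (v + v')%R w = (bracket v w + bracket v' w)%R.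
Proof. exact (additive_coords (bracket_coord w) v v'). Qed.

Lemma bracketDr (v w w' : 'rV[R]_k) :
  bracket v (w + w')%R = (bracket v w + bracket v w')%R.
Proof.
have D := is_deriveD (bracket_derive v w) (bracket_derive v w').
by apply: (is_derive_inj (bracket_derive v (w + w')%R) D) => t; rewrite AdD.
Qed.

Lemma bracketJ (v w : 'rV[R]_k) : bracket v (w *m J)%R = (bracket v w *m J)%R.
Proof.
have D := is_derive_linear (mulmxr J) (bracket_derive v w).
by apply: (is_derive_inj (bracket_derive v (w *m J)%R) D) => t; rewrite /= Ad_J.
Qed.

Lemma Ad_exp_id (v : 'rV[R]_k) (t : R) : Ad (exp (t *: v)%R) v = v.
Proof.
have [gD _ dv] := exp_one_param v.
apply: (is_derive_inj (Ad_velocity (exp (t *: v)%R) v) dv) => s /=.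
by rewrite -gD addrC gD mulgK.
Qed.

Lemma bracketvv (v : 'rV[R]_k) : bracket v v = 0%R.
Proof.
apply: (is_derive_inj (bracket_derive v v) (is_derive_cst v (0%R : R) (1%R : R))) => t.
exact: Ad_exp_id.
Qed.

(** Polarisation of [bracketvv]. It carries the compatibility with [J] from the second argument to
    the first. *)
Lemma bracketC (v w : 'rV[R]_k) : bracket v w = (- bracket w v)%R.
Proof. exact (alternating_antisym bracketDl bracketDr bracketvv v w). Qed.

End Bracket.

(** * Commuting exponentials and Abelian subalgebras of iu *)

Section CommutingExponentials.
Variable R : realType.
Variable UC : complexLieGroup R.
Local Notation k := (lg_dim UC).
Local Notation exp := (@lg_exp R UC).
Local Notation J := (lg_J UC).
Local Open Scope group_scope.

Lemma is_derive_comp_linear n p (F : 'rV[R]_n -> 'rV[R]_p) (f : R -> 'rV[R]_n) (s : R) v :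
  linear F -> is_derive s (1%R : R) f v -> is_derive s (1%R : R) (F \o f) (F v).
Proof.
move=> lF df.
pose FM := GRing.isLinear.Build _ _ _ _ _ lF.
pose FL : {linear 'rV[R]_n -> 'rV[R]_p} := HB.pack F FM.
exact (is_derive_linear FL df).
Qed.

Lemma is_derive0_cst n (f : R -> 'rV[R]_n) (x y : R) :
  (forall t, is_derive t (1%R : R) f 0%R) -> f x = f y.
Proof.
move=> df; apply/rowP => i.
apply: (@is_derive_0_is_cst R (fun t => f t 0%R i)) => t.
by have := is_derive_coord i (df t); rewrite mxE.
Qed.

(** The curve s |-> Ad (exp (s v)) w has velocity Ad (exp (s v)) [v, w] = 0 at every time, so it is
    constant. *)
Lemma Ad_exp_fixed (v w : 'rV[R]_k) (t : R) :
  bracket v w = 0%R -> Ad (exp (t *: v)%R) w = w.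
Proof.
move=> vw0; pose f (s : R) := Ad (exp (s *: v)%R) w.
have df0 : is_derive (0%R : R) (1%R : R) f 0%R by rewrite -vw0; exact: bracket_derive.
have [gD _ _] := exp_one_param v.
have f0 : f 0%R = w by rewrite /f scale0r lg_exp0 Ad1.
rewrite -[RHS]f0; apply: (@is_derive0_cst _ f) => s.
have fE : (Ad (exp (s *: v)%R) \o (fun r => f (1 * r + - s)%R)) =1 f.
  by move=> r; rewrite /f /= -AdM -gD mul1r subrKC.
rewrite -(funext fE).
have := @is_derive_affine _ _ f 1%R (- s)%R s 0%R.
rewrite mul1r subrr => /(_ df0); rewrite scaler0 => dfs.
by have := is_derive_comp_linear (Ad_linear (exp (s *: v)%R)) dfs; rewrite Ad0.
Qed.

Lemma exp_commute (v w : 'rV[R]_k) (s t : R) : bracket v w = 0%R ->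
  exp (s *: v)%R * exp (t *: w)%R = exp (t *: w)%R * exp (s *: v)%R.
Proof.
by move=> /(Ad_exp_fixed s) Adw; rewrite -{2}Adw exp_Ad mulgVK.
Qed.

(** The product of two commuting one-parameter subgroups is a one-parameter subgroup, with velocity
    [v + w]. *)
Lemma lg_expD (v w : 'rV[R]_k) : bracket v w = 0%R ->
  exp (v + w)%R = exp v * exp w.
Proof.
move=> vw0.
have ov := exp_one_param v; have ow := exp_one_param w.
have [vD cv _] := ov; have [wD cw _] := ow.
have o : one_param (fun t : R => exp (t *: v)%R * exp (t *: w)%R) (v + w)%R.
  split; last exact: one_param_mul_velocity.
  - move=> s t; rewrite vD wD -!mulgA; congr (_ * _).
    by rewrite !mulgA; congr (_ * _); rewrite exp_commute.
  - exact: curve_mul_continuous.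
have := one_param_unique (exp_one_param (v + w)%R) o => /(congr1 (@^~ 1%R)).
by rewrite !scale1r.
Qed.

(** A subspace is the kernel of the identity minus a projection, and linear maps commute with
    derivatives. *)
Lemma is_derive_memv n (V : {vspace 'rV[R]_n}) (f : R -> 'rV[R]_n) (s : R) v :
  is_derive s (1%R : R) f v -> (forall t, f t \in V) -> v \in V.
Proof.
move=> df fV.
have lL : linear (fun x => x - projv V x)%R.
  by move=> a x y; rewrite linearP scalerBr opprD addrACA.
have d1 := is_derive_comp_linear lL df.
have : (v - projv V v = 0)%R.
  apply: (is_derive_inj d1 (is_derive_cst (0%R : 'rV[R]_n) s (1%R : R))) => t.
  by rewrite /= projv_id ?subrr.
by move/eqP; rewrite subr_eq0 => /eqP ->; exact: memv_proj.
Qed.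

Lemma mem_imul (V : {vspace 'rV[R]_k}) v :
  v \in imul V -> exists2 w, w \in V & v = (w *m J)%R.
Proof. by move=> /memv_imgP[w wV ->]; exists w => //; rewrite lfunE. Qed.

Lemma mulmxJJ (v : 'rV[R]_k) : (v *m J *m J = - v)%R.
Proof.
by rewrite -mulmxA (complex_structure (lg_manifold UC)) mulmxN mulmx1.
Qed.

Variables (U : set UC) (u : {vspace 'rV[R]_k}).
Hypothesis UCcx : is_complexification U u.

Lemma Ad_compact (g : UC) w : U g -> w \in u -> Ad g w \in u.
Proof.
move=> Ug /(cx_lie UCcx) Uw; apply/(cx_lie UCcx) => t; rewrite exp_Ad.
have [U1 UM UV] := cx_subgroup UCcx.
by apply: (UM); [apply: (UM) => //; exact: Uw|exact: UV].
Qed.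

Lemma bracket_compact v w : v \in u -> w \in u -> bracket v w \in u.
Proof.
move=> vu wu; apply: (is_derive_memv (bracket_derive v w)) => t.
by apply: Ad_compact => //; exact: ((cx_lie UCcx v).1 vu t).
Qed.

(** By complex bilinearity [J v', J w'] = - [v', w'], which lies in [u]. *)
Lemma bracket_imul v w : v \in imul u -> w \in imul u -> bracket v w \in u.
Proof.
move=> /mem_imul[v' v'u ->] /mem_imul[w' w'u ->].
rewrite bracketJ bracketC bracketJ mulNmx mulmxJJ opprK.
exact: bracket_compact.
Qed.

(** The bracket lies in [u] by [bracket_imul] and in [imul u] because [a] is closed under it; these
    two spaces meet only in 0. *)
Lemma subalgebra_bracket0 (a : {vspace 'rV[R]_k}) v w :
  (a <= imul u)%VS -> (forall v w, v \in a -> w \in a -> bracket v w \in a) ->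
  v \in a -> w \in a -> bracket v w = 0%R.
Proof.
move=> au aB va wa; apply/eqP; rewrite -memv0 -(cx_direct UCcx) memv_cap.
by rewrite bracket_imul ?(subvP au) // aB.
Qed.

End CommutingExponentials.

Lemma is_derive_max0 (R : realType) (F : R -> R) (s d : R) :
  is_derive s 1 F d -> (forall t, F t <= F s) -> d = 0.
Proof.
have le0 (G : R -> R) (r c : R) : is_derive r 1 G c -> (forall t, G t <= G r) -> c <= 0.
  move=> [dG <-] Gmax; rewrite leNgt; apply/negP => c0.
  have /cvgr_gt /(_ 0 c0) := dG.
  move=> /nbhs_ballP[e /= e0 eP].
  have e2 : 0 < e / 2 by lra.
  have eb : ball 0 e (e / 2) by rewrite /ball /= sub0r normrN gtr0_norm; lra.
  have := eP _ eb; rewrite gt_eqF // => /(_ isT).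
  move=> h; have : 0 < (e / 2)^-1 * (G ((e / 2)%:A + r) - G r) := h.
  by rewrite pmulr_rgt0 ?invr_gt0 // subr_gt0 ltNge Gmax.
move=> dF Fmax; apply/eqP; rewrite eq_le (le0 F s) //=.
have := @is_derive_affine _ _ F (-1) 0 (- s) d.
rewrite mulN1r opprK addr0 => /(_ dF) dF'.
rewrite -oppr_le0 -scaleN1r; apply: (le0 _ _ _ dF') => t.
by rewrite !mulN1r opprK !addr0 Fmax.
Qed.

(** * Gradient flows of the action *)

Section Action.
Variable R : realType.
Variable UC : complexLieGroup R.
Variable Z : complexManifold R.
Local Notation k := (lg_dim UC).
Local Notation exp := (@lg_exp R UC).
Local Notation c1 := (lg_chart1 UC).
Local Notation atlZ := (@atlas R Z).
Variable act : UC -> Z -> Z.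
Hypothesis actP : is_holomorphic_action act.

Lemma cm_is_chart c : atlZ c -> is_chart c.
Proof. by move=> Ac; exact (atlas_is_chart (cmP Z) Ac). Qed.

Lemma cm_cover (z : Z) : exists2 c, atlZ c & dom c z.
Proof. exact (atlas_cover (cmP Z) z). Qed.

Lemma act_continuous : continuous (fun x : UC * Z => act x.1 x.2).
Proof. exact: (act_holomorphic actP).1.1. Qed.

Lemma curve_act_continuous (T : topologicalType) (a : T -> UC) (b : T -> Z) :
  continuous a -> continuous b -> continuous (fun t => act (a t) (b t)).
Proof.
move=> ca cb t.
exact (continuous_comp (cvg_pair (ca t) (cb t)) (@act_continuous (a t, b t))).
Qed.

Lemma act_curve c c' d (a : R -> UC) (b : R -> Z) (s : R) v w :
  (@lg_atlas R UC) c -> atlZ c' -> atlZ d ->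
  {for s, continuous a} -> {for s, continuous b} ->
  dom c (a s) -> dom c' (b s) -> dom d (act (a s) (b s)) ->
  is_derive s 1 (coord c \o a) v -> is_derive s 1 (coord c' \o b) w ->
  is_derive s 1 (coord d \o (fun t => act (a t) (b t)))
    ('d (local_rep (prod_chart c c') d (fun x : UC * Z => act x.1 x.2))
      (row_mx (coord c (a s)) (coord c' (b s))) (row_mx v w)).
Proof.
move=> Ac Ac' Ad ca cb cs cs' ds da db.
exact (@prod_curve_comp R _ _ _ _ _ _ _ _ _ (fun x : UC * Z => act x.1 x.2) c c' d a b s v w
  (act_holomorphic actP).1 Ac Ac' Ad (lg_is_chart Ac) (cm_is_chart Ac') ca cb cs cs' ds da db).
Qed.

Definition flow (v : 'rV[R]_k) (z : Z) (t : R) := act (exp (t *: v)) z.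

Lemma flow0 v z : flow v z 0 = z.
Proof. by rewrite /flow scale0r lg_exp0 (act1 actP). Qed.

Lemma flowD v z s t : flow v z (s + t) = act (exp (s *: v)) (flow v z t).
Proof. by have [gD _ _] := exp_one_param v; rewrite /flow gD (actM actP). Qed.

Lemma flow_flow v z s t : flow v z (s + t) = flow v (flow v z t) s.
Proof. exact: flowD. Qed.

Lemma flow_continuous v z : continuous (flow v z).
Proof.
have [_ cv _] := exp_one_param v.
by apply: curve_act_continuous => // t; exact: cvg_cst.
Qed.

Lemma flow_velocity v z c : atlZ c -> dom c z ->
  is_derive (0 : R) 1 (coord c \o flow v z) (fund act c v z).
Proof.
move=> Ac cz; have [_ cv dv] := exp_one_param v.
have cc : {for 0, continuous (cst z : R -> Z)} by exact: cvg_cst.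
have := @act_curve c1 c c (fun t : R => exp (t *: v)) (cst z) 0 v 0
  (lg_chart1_atlas UC) Ac Ac (cv 0) cc.
rewrite /= scale0r lg_exp0 (act1 actP) => /(_ (lg_chart1_dom UC) cz cz dv).
move=> /(_ (is_derive_cst (coord c z) (0 : R) (1 : R))) [D _].
by split.
Qed.

(** Translation by exp (s v) carries the velocity at time 0 to the velocity at time [s]. So a zero
    of the fundamental field at [z] makes all velocities of its orbit vanish. *)
Lemma flow_fixed v z c : atlZ c -> dom c z -> fund act c v z = 0 ->
  forall t, flow v z t = z.
Proof.
move=> Ac cz f0 t.
have d0 := flow_velocity v Ac cz; rewrite f0 in d0.
rewrite -[RHS](flow0 v z).
apply: (zero_velocity_const (cmP Z) (@flow_continuous v z)) => s d Ad ds.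
have [cg Acg cgg] := lg_cover (exp (s *: v)).
have E : coord d \o flow v z =1 (fun t => (coord d \o (fun t => act (exp (s *: v)) (flow v z t))) (1 * t + - s)).
  by move=> r /=; rewrite -flowD mul1r subrKC.
rewrite (funext E) -[X in is_derive _ _ _ X](scaler0 _ 1).
apply: is_derive_affine; rewrite mul1r subrr.
have := @act_curve cg c d (cst (exp (s *: v))) (flow v z) 0 0 0 Acg Ac Ad
  (@cst_continuous_at _ _ _ 0) (@flow_continuous v z 0) cgg _ _ (cst_velocity _ _ _) d0.
rewrite flow0 row_mx0 linear0; apply => //=.
Qed.

Section Gradient.
Variables (omega : form2 Z) (f : Z -> R) (v : 'rV[R]_k).
Hypothesis omegaP : is_kahler omega.
Hypothesis fD : forall c z, atlZ c -> dom c z -> differentiable (f \o param c) (coord c z).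
Hypothesis fG : is_gradient act omega f v.

Lemma flow_gradient z c : atlZ c -> dom c z ->
  is_derive (0 : R) 1 (f \o flow v z)
    (kmetric omega c (coord c z) (fund act c v z) (fund act c v z)).
Proof.
move=> Ac cz.
have D : differentiable (f \o param c) ((coord c \o flow v z) 0).
  by rewrite /= flow0; exact: fD.
have := is_derive_curve_comp (flow_velocity v Ac cz) D.
rewrite -deriveE // [X in is_derive _ _ _ ('D_ _ _ X)](_ : _ = coord c z) /= ?flow0 // fG //.
apply: near_eq_is_derive.
have cf : {for 0, continuous (flow v z)} by exact: flow_continuous.
near=> t; rewrite /= (coordK (cm_is_chart Ac)) //.
near: t; apply: cf; rewrite flow0.
by apply: open_nbhs_nbhs; split => //; exact: open_dom (cm_is_chart Ac).
Unshelve. all: by end_near.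
Qed.

Lemma flow_derive z (s : R) : exists c, [/\ atlZ c, dom c (flow v z s) &
  is_derive s 1 (f \o flow v z)
    (kmetric omega c (coord c (flow v z s)) (fund act c v (flow v z s))
       (fund act c v (flow v z s)))].
Proof.
have [c Ac cz] := cm_cover (flow v z s); exists c; split => //.
have E : f \o flow v z =1 (fun t => (f \o flow v (flow v z s)) (1 * t + - s)).
  by move=> r /=; rewrite -flow_flow mul1r subrK.
rewrite (funext E) -[X in is_derive _ _ _ X]scale1r.
apply: is_derive_affine; rewrite mul1r subrr; exact: flow_gradient.
Qed.

Lemma kmetric_ge0 c z w : atlZ c -> dom c z -> 0 <= kmetric omega c (coord c z) w w.
Proof.
move=> Ac cz; have [->|w0] := eqVneq w 0.
  by rewrite /kmetric /bil !mul0mx mxE.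
by apply/ltW/(kahler_pos omegaP) => //; exists z.
Qed.

Lemma flow_nondecreasing z (s t : R) : s <= t -> f (flow v z s) <= f (flow v z t).
Proof.
move=> st.
have D r : derivable (f \o flow v z) r 1.
  by have [c [_ _ []]] := flow_derive z r.
have cf : {within `[s, t], continuous (f \o flow v z)}.
  by apply: derivable_within_continuous => x _; exact: D.
have dr x : x \in `]s, t[ -> is_derive x 1 (f \o flow v z) ('D_1 (f \o flow v z) x).
  by move=> _; exact/derivableP.
have [r _ /= E] := MVT_segment st dr cf.
rewrite -subr_ge0 E mulr_ge0 ?subr_ge0 //.
have [c [Ac cz [_ ->]]] := flow_derive z r.
exact: kmetric_ge0.
Qed.

Lemma flow_strict z : f (flow v z 1) = f z -> flow v z 1 = z.
Proof.
move=> fz; have h2 : (0 : R) < 2^-1 by rewrite invr_gt0.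
(* [f] is constant along the orbit on [0, 1], so its velocity vanishes at time 1/2. *)
have [c [Ac cy D]] := flow_derive z 2^-1.
have d0 : is_derive (2^-1 : R) 1 (f \o flow v z) 0.
  have t0 : \forall t \near (2^-1 : R), 0 < t.
    by have /cvgr_gt := @cvg_id _ (nbhs (2^-1 : R)); apply.
  have t1 : \forall t \near (2^-1 : R), t < 1.
    by have /cvgr_lt := @cvg_id _ (nbhs (2^-1 : R)); apply; lra.
  have E : \forall t \near (2^-1 : R), cst (f z) t = (f \o flow v z) t.
    apply: filterS2 t0 t1 => t t0 t1; apply/eqP; rewrite /cst /= eq_le.
    rewrite -{1}(flow0 v z) flow_nondecreasing ?(ltW t0) //=.
    by rewrite -fz flow_nondecreasing // ltW.
  exact (near_eq_is_derive E (is_derive_cst (f z) (2^-1 : R) (1 : R))).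
have : kmetric omega c (coord c (flow v z 2^-1)) (fund act c v (flow v z 2^-1))
       (fund act c v (flow v z 2^-1)) = 0.
  by case: D => _ <-; case: d0.
have [f0 _|f0] := eqVneq (fund act c v (flow v z 2^-1)) 0; last first.
  move=> k0; have := kahler_pos omegaP Ac _ f0; rewrite -/(kmetric _ _ _ _ _).
  move=> /(_ (coord c (flow v z 2^-1))); rewrite k0 ltxx => h.
  by have : false by apply: h; exists (flow v z 2^-1).
have fix1 := flow_fixed Ac cy f0.
have -> : (1 : R) = 2^-1 + 2^-1 by field.
(* The point at time 1/2 is fixed by the flow; moving from it by +1/2 and by -1/2 identifies the
   points at times 1 and 0. *)
rewrite flow_flow fix1 -(fix1 (- 2^-1)) -flow_flow addNr; exact: flow0.
Qed.

End Gradient.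

End Action.

(** * Borel measurability of continuous maps *)

Section BorelSubspace.
Variables (T : topologicalType) (x0 : T).

Lemma open_borel (S : set (borel x0)) : @open T S -> measurable S.
Proof. exact: sub_sigma_algebra. Qed.

Lemma continuous_measurable_borel (R : realType) (g : T -> R) :
  continuous g -> measurable_fun [set: borel x0] (g : borel x0 -> R).
Proof.
move=> /continuousP cg; apply: (measurability _ (RGenOpens.measurableE R)).
move=> _ [_ [a [b ->] <-]]; rewrite setTI; apply: open_borel.
exact/cg/interval_open.
Qed.

Lemma continuous_borel_borel (g : T -> T) :
  continuous g -> measurable_fun [set: borel x0] (g : borel x0 -> borel x0).
Proof.
move=> /continuousP cg; apply: (@measurability _ _ (borel x0) (borel x0) setT (g : borel x0 -> borel x0) (@open T)) => //.
by move=> _ [S oS <-]; rewrite setTI; apply: open_borel; exact: cg.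
Qed.

End BorelSubspace.

(** * The flow on [M] and its limits on the open unstable manifold *)

Section SubmanifoldFlow.
Variable R : realType.
Variable UC : complexLieGroup R.
Variable Z : complexManifold R.
Local Notation k := (lg_dim UC).
Local Notation exp := (@lg_exp R UC).
Local Notation atlZ := (@atlas R Z).
Variable act : UC -> Z -> Z.
Hypothesis actP : is_holomorphic_action act.
Variable M : set Z.

Lemma set_val_continuous : continuous (val : set_type M -> Z).
Proof. exact: initial_continuous. Qed.

Lemma comp_set_val_continuous (S : topologicalType) (f : Z -> S) : continuous f ->
  continuous (fun x : set_type M => f (val x)).
Proof. exact (continuousT_comp set_val_continuous). Qed.

Lemma val_act_on g x : (forall x, M x -> M (act g x)) ->
  val (act_on act g x : set_type M) = act g (val x).
Proof.
move=> gM; rewrite /act_on val_insubd ifT // inE; apply: gM.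
exact: set_valP.
Qed.

Lemma act_on_continuous g : (forall x, M x -> M (act g x)) ->
  continuous (act_on act g : set_type M -> set_type M).
Proof.
move=> gM; apply: continuous_comp_initial.
have -> : (val : set_type M -> Z) \o act_on act g = (fun x => act g (val x)).
  by apply/funext => x /=; rewrite val_act_on.
apply: (comp_set_val_continuous (f := act g)) => z.
have cg : continuous (fun _ : Z => g) by move=> ?; exact: cvg_cst.
have ci : continuous (fun z : Z => z) by move=> ?; exact: cvg_id.
exact (curve_act_continuous actP cg ci (x := z)).
Qed.

Variable f : Z -> R.
Hypothesis fC : continuous f.
Hypothesis fD : forall c z, atlZ c -> dom c z -> differentiable (f \o param c) (coord c z).

(** Along an admissible curve the chain rule in a chart of [Z] gives a derivative, and it vanishes
    because the curve passes through a maximum at time 0. *)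
Lemma max_critical (x : set_type M) :
  (forall y : set_type M, f (val y) <= f (val x)) ->
  critical (fun y : set_type M => f (val y)) x.
Proof.
move=> fmax gamma g0 cg dg.
have [c Ac cx] := cm_cover (val x).
have dcg := derivableP (dg c Ac cx).
have D : differentiable (f \o param c) ((fun t => coord c (val (gamma t))) 0).
  by rewrite /= g0; exact: fD.
have := is_derive_curve_comp dcg D; set d := 'd _ _ _ => dF.
have E : \forall t \near (0 : R), ((f \o param c) \o (fun t => coord c (val (gamma t)))) t
    = ((fun y : set_type M => f (val y)) \o gamma) t.
  have cvg : {for 0, continuous (fun t => val (gamma t))}.
    exact (continuous_comp cg (@set_val_continuous (gamma 0))).
  near=> t; rewrite /= (coordK (cm_is_chart Ac)) //.
  near: t; apply: cvg; rewrite g0.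
  by apply: open_nbhs_nbhs; split => //; exact: open_dom (cm_is_chart Ac).
have dfg := near_eq_is_derive E dF.
have d0 : d = 0 by apply: (is_derive_max0 dfg) => t /=; rewrite g0; exact: fmax.
by rewrite d0 in dfg.
Unshelve. all: by end_near.
Qed.

Lemma exists_max (x0 : set_type M) : compact M ->
  exists x : set_type M, forall y : set_type M, f (val y) <= f (val x).
Proof.
move=> cM.
have [||x xM xmax] := @compact_EVT_max Z R f M _ cM.
- by exists (val x0); exact: set_valP.
- exact: continuous_subspaceT.
exists (SigSub xM) => y; apply: xmax; rewrite inE; exact: set_valP.
Qed.

(** A maximum exists by compactness and is critical, so the largest critical value dominates [f]
    everywhere. The flow of [x] converges to a point at that level. *)
Lemma top_unstable_limit (v : 'rV[R]_k) (x x' : set_type M) (e : R) : compact M -> 0 < e ->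
  top_unstable act (fun y : set_type M => f (val y)) v x ->
  \forall s \near +oo, f (val x') - e <= f (val (act_on act (exp (s *: v)) x)).
Proof.
move=> cM e0 [c [cv cmax [y [lim cy fy]]]].
have [xm xmP] := exists_max x' cM.
have x'y : f (val x') <= f (val y).
  apply: le_trans (xmP x') _; rewrite fy; apply: cmax; exists xm => //.
  exact: max_critical.
have lim2 : (fun s : R => f (val (act_on act (exp (s *: v)) x))) @ +oo --> f (val y).
  exact (cvg_comp _ _ lim (@comp_set_val_continuous _ f fC y)).
have /cvgrPdist_lt /(_ _ e0) := lim2.
apply: filterS => s; rewrite ltr_distlC => /andP[h1 h2]; lra.
Qed.

End SubmanifoldFlow.

(** * Orthogonal projections and the gradient map *)

Section OrthogonalProjection.
Variables (R : realType) (UC : complexLieGroup R).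
Local Notation k := (lg_dim UC).
Implicit Types (Q : 'M[R]_k) (V : {vspace 'rV[R]_k}).

Definition basis_mx V : 'M[R]_(\dim V, k) := \matrix_i (vbasis V)`_i.

Lemma mul_basis_mx V (c : 'rV[R]_(\dim V)) :
  c *m basis_mx V = \sum_i c 0 i *: (vbasis V)`_i.
Proof. by rewrite mulmx_sum_row; apply: eq_bigr => i _; rewrite rowK. Qed.

Lemma mul_basis_mx_in V c : c *m basis_mx V \in V.
Proof.
rewrite mul_basis_mx; apply: memv_suml => i _; apply: memvZ; apply: vbasis_mem.
by rewrite mem_nth // size_tuple.
Qed.

Lemma mem_basis_mx V v : v \in V -> exists c, v = c *m basis_mx V.
Proof.
move=> vV; exists (\row_i vector.coord (vbasis V) i v).
by rewrite mul_basis_mx {1}(coord_vbasis vV); apply: eq_bigr => i _; rewrite mxE.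
Qed.

Lemma mul_basis_mx_eq0 V (c : 'rV[R]_(\dim V)) : c *m basis_mx V = 0 -> c = 0.
Proof.
rewrite mul_basis_mx => /(freeP (basis_free (vbasisP V))) c0.
by apply/rowP => i; rewrite c0 mxE.
Qed.

Lemma bilBl Q u v w : bil Q (u - v) w = bil Q u w - bil Q v w.
Proof. by rewrite /bil !mulmxBl !mxE. Qed.

Variables (Q : 'M[R]_k) (V : {vspace 'rV[R]_k}).
Hypothesis Qpos : forall v, v \in V -> v != 0 -> 0 < bil Q v v.

Definition gram := basis_mx V *m Q *m (basis_mx V)^T.

(** A row vector killed by the Gram matrix represents an element of [V] isotropic for [Q], hence 0
    by positivity. *)
Lemma gram_unit : gram \in unitmx.
Proof.
rewrite -row_free_unit -kermx_eq0; apply/eqP/row_matrixP => i.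
rewrite row0; set c := row i _.
have cG : c *m gram = 0 by rewrite -row_mul mulmx_ker row0.
apply: mul_basis_mx_eq0; apply/eqP/negP => /negP /(Qpos (mul_basis_mx_in c)).
by rewrite /bil trmx_mul !mulmxA -(mulmxA c) -(mulmxA c) cG !mul0mx mxE ltxx.
Qed.

(** The solution of the normal equations: the factors before the last [basis_mx V] produce the
    coordinates of the projection in the basis. *)
Definition proj_mx : 'M[R]_k := Q *m (basis_mx V)^T *m invmx gram *m basis_mx V.

(** The matrix formula meets the defining conditions of the projection, and positivity of [Q] on [V]
    makes the solution unique, so [xget] never falls back on its default 0. *)
Lemma orth_projE v : orth_proj Q V v = v *m proj_mx.
Proof.
have P1 : v *m proj_mx \in V by rewrite /proj_mx !mulmxA mul_basis_mx_in.
have P2 x : x \in V -> bil Q (v - v *m proj_mx) x = 0.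
  move=> /mem_basis_mx[c ->]; rewrite bilBl /bil trmx_mul /proj_mx !mulmxA.
  set X := v *m Q *m _; rewrite -(mulmxA _ (basis_mx V)) -(mulmxA _ _ (basis_mx V)^T).
  by rewrite -/gram mulmxKV ?gram_unit // subrr.
rewrite /orth_proj; case: xgetP => [w _ [wV wP]|/(_ (v *m proj_mx))]; last by case.
apply/eqP; rewrite -subr_eq0; apply/negPn/negP => d0.
have dV : w - v *m proj_mx \in V by rewrite memvB.
have := Qpos dV d0.
have E (z : 'rV[R]_k) : w - z = (v - z) - (v - w).
  by apply/rowP => i; rewrite !mxE; ring.
by rewrite [X in bil Q X _]E bilBl P2 // wP // subrr ltxx.
Qed.

End OrthogonalProjection.

Lemma row_basis_mx (R : realType) (UC : complexLieGroup R)
    (V : {vspace 'rV[R]_(lg_dim UC)}) i : row i (basis_mx V) \in V.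
Proof. by rewrite rowE mul_basis_mx_in. Qed.

(** Continuity of [lg_exp] is given along lines only. On a commuting subspace the exponential of a
    combination of basis vectors is a product of exponentials along lines, hence continuous in all
    coordinates jointly. *)
Lemma lg_exp_continuous_on (R : realType) (UC : complexLieGroup R)
    (V : {vspace 'rV[R]_(lg_dim UC)}) :
  (forall v w, v \in V -> w \in V -> bracket v w = 0) ->
  continuous (fun y : 'rV[R]_(\dim V) => @lg_exp R UC (y *m basis_mx V)).
Proof.
move=> V0; under eq_fun do rewrite mulmx_sum_row.
have SV (s : seq 'I_(\dim V)) (y : 'rV[R]_(\dim V)) :
    \sum_(i <- s) y 0 i *: row i (basis_mx V) \in V.
  by apply: memv_suml => i _; apply/memvZ/row_basis_mx.
have H (s : seq 'I_(\dim V)) : continuous (fun y : 'rV[R]_(\dim V) =>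
    @lg_exp R UC (\sum_(i <- s) y 0 i *: row i (basis_mx V))); last exact: H.
elim: s => [|i s IH].
  have -> : (fun y : 'rV[R]_(\dim V) => @lg_exp R UC (\sum_(i <- [::]) y 0 i *: row i (basis_mx V)))
      = cst (lg_exp 0) by apply/funext => y; rewrite big_nil.
  by move=> y; exact (@cst_continuous _ _ (lg_exp 0) y).
have -> : (fun y : 'rV[R]_(\dim V) => @lg_exp R UC (\sum_(j <- i :: s) y 0 j *: row j (basis_mx V)))
    = (fun y => lg_exp (y 0 i *: row i (basis_mx V)) *
                lg_exp (\sum_(j <- s) y 0 j *: row j (basis_mx V)))%g.
  by apply/funext => y; rewrite big_cons lg_expD // V0 // memvZ // row_basis_mx.
apply: curve_mul_continuous => //.
have [_ ce _] := lg_expP (row i (basis_mx V)).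
exact (continuousT_comp (@matrix_normedtype.coord_continuous R 1 _ 0 i) ce).
Qed.

Lemma continuous_in_charts (R : realType) (Z : complexManifold R) n (f : Z -> 'rV[R]_n) :
  (forall c, @atlas R Z c -> smooth_on (chart_image c) (f \o param c)) -> continuous f.
Proof.
move=> sf z; have [c Ac cz] := cm_cover z; have hc := cm_is_chart Ac.
have df : {for coord c z, continuous (f \o param c)}.
  by have := sf c Ac 0%N (coord c z); apply; exists z.
have cg : f (param c (coord c y)) @[y --> z] --> f (param c (coord c z)).
  exact (continuous_comp (coord_continuous hc cz) df).
rewrite (coordK hc cz) in cg.
apply: (cvg_trans _ cg); apply: near_eq_cvg; near=> y; rewrite (coordK hc) //.
by near: y; apply: open_nbhs_nbhs; split => //; exact: open_dom.
Unshelve. all: by end_near.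
Qed.

Lemma mulmx_dot (R : realType) n k (u : 'rV[R]_n) (H : 'M[R]_(n, k)) j :
  (u *m H) 0 j = dot u (\row_i H i j).
Proof. by rewrite mxE; apply: eq_bigr => i _; rewrite mxE. Qed.

Lemma mean_mulmx (R : realType) (d : measure_display) (T : measurableType d)
    (P : probability T R) n k (L : R) (m : T -> 'rV[R]_n) (H : 'M[R]_(n, k)) j :
  measurable_coords m -> (forall x, `|m x| <= L) ->
  (\int[P]_x (m x *m H) 0 j)%R = (mean P m *m H) 0 j.
Proof.
move=> mm mL; rewrite mulmx_dot (dot_mean _ _ mm mL); congr fine.
by apply: eq_integral => x _; rewrite mulmx_dot.
Qed.

Lemma dot_mulmxE (R : realType) n (u v : 'rV[R]_n) : dot u v = (u *m v^T) 0 0.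
Proof. by rewrite mxE; apply: eq_bigr => i _; rewrite mxE. Qed.

(** * Regularity of the gradient map *)

Section GradientMap.
Variables (R : realType) (Z : complexManifold R) (UC : complexLieGroup R).
Local Notation k := (lg_dim UC).
Variables (U : set UC) (u : {vspace 'rV[R]_k}).
Variables (Q : 'M[R]_k) (B : 'M[R]_k).
Hypothesis QP : is_invariant_scalar_product U u Q.
Variables (p : {vspace 'rV[R]_k}).
Hypothesis pu : (p <= imul u)%VS.

(** Positivity of [Q] is known on [u]; this inclusion makes it available for the projection onto
    ip. *)
Lemma imul_imul_sub : (imul p <= u)%VS.
Proof.
apply/subvP => v /mem_imul[w /(subvP pu) /mem_imul[x xu ->] ->].
by rewrite mulmxJJ memvN.
Qed.

(** The gradient map is a constant matrix applied to [mu], so it inherits continuity and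
    differentiability. *)
Lemma mu_pE (mu : Z -> 'rV[R]_k) z :
  mu_p Q p mu z = mu z *m - (proj_mx Q (imul p) *m lg_J UC).
Proof.
rewrite /mu_p orth_projE ?mulmxN ?mulmxA // => v /(subvP imul_imul_sub).
by move=> vu; exact (sp_pos QP vu).
Qed.

Variables (act : UC -> Z -> Z) (omega : form2 Z) (mu : Z -> 'rV[R]_k).
Hypothesis muP : is_momentum_map act U u Q omega mu.

Lemma mu_p_bil_differentiable v c z : @atlas R Z c -> dom c z ->
  differentiable ((fun z => bil B (mu_p Q p mu z) v) \o param c) (coord c z).
Proof.
move=> Ac cz.
have dmu : differentiable (mu \o param c) (coord c z).
  by have [+ _] := mom_smooth muP Ac 1%N; apply; exists z.
have E : (fun z => bil B (mu_p Q p mu z) v) \o param c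
    =1 (fun y => mulmxr (- (proj_mx Q (imul p) *m lg_J UC) *m B *m v^T) y 0 0) \o (mu \o param c).
  by move=> y; rewrite /bil /= mu_pE !mulmxA.
rewrite (funext E); apply: differentiable_comp dmu _.
apply: differentiable_coord_comp.
exact/linear_differentiable/linear_rV_continuous.
Qed.

Lemma mu_p_continuous : continuous (mu_p Q p mu).
Proof.
have -> : mu_p Q p mu = (fun z => mulmxr (- (proj_mx Q (imul p) *m lg_J UC)) (mu z)).
  by apply/funext => z; rewrite mu_pE.
apply: continuousT_comp; last exact: linear_rV_continuous.
by apply: continuous_in_charts => c Ac; exact (mom_smooth muP Ac).
Qed.

End GradientMap.

Lemma gradient_mean_pushforward (R : realType) (UC : complexLieGroup R)
    (Z : complexManifold R) (M : set Z) (x0 : set_type M)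
    (nu : probability (borel x0) R) (tau : borel x0 -> borel x0) (L : R)
    (f : set_type M -> 'rV[R]_(lg_dim UC)) :
  measurable_fun setT tau -> measurable_coords (f : borel x0 -> _) ->
  (forall x : borel x0, `|f x| <= L) ->
  gradient_mean f (pushforward nu tau) = mean nu (fun x => f (tau x)).
Proof.
move=> mtau mf fL; apply/rowP => j; rewrite !mxE /Rintegral; congr fine.
have mfj : measurable_fun setT (fun x : borel x0 => (f x 0 j)%:E).
  apply/measurable_EFinP; have h := mf j; exact h.
have ifj : nu.-integrable (tau @^-1` setT) ((fun x : borel x0 => (f x 0 j)%:E) \o tau).
  rewrite preimage_setT.
  apply: (@coord_integrable _ _ _ nu _ L (fun x => f (tau x))) => // i.
  exact: (measurableT_comp (mf i) mtau).
by have := integral_pushforward mtau mfj ifj measurableT; rewrite preimage_setT.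
Qed.

Theorem theorem4p7 (R : realType)
  (Z : complexManifold R) (omega : form2 Z)
  (Zcompact : compact [set: Z]) (Zconnected : connected [set: Z])
  (Zkahler : is_kahler omega)
  (UC : complexLieGroup R) (U : set UC) (u : {vspace 'rV[R]_(lg_dim UC)})
  (UCcx : is_complexification U u)
  (act : UC -> Z -> Z) (actP : is_holomorphic_action act)
  (Uomega : forall g, U g -> preserves omega (act g))
  (Q : 'M[R]_(lg_dim UC)) (QP : is_invariant_scalar_product U u Q)
  (mu : Z -> 'rV[R]_(lg_dim UC)) (muP : is_momentum_map act U u Q omega mu)
  (B : 'M[R]_(lg_dim UC)) (BP : is_invariant_form u B)
  (G : set UC) (p : {vspace 'rV[R]_(lg_dim UC)})
  (GP : is_compatible U u G p)
  (mupP : forall beta, beta \in p ->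
     is_gradient act omega (fun z => bil B (mu_p Q p mu z) beta) beta)
  (M : set Z) (d : nat) (Msub : is_submanifold (@atlas _ Z) d M)
  (Mcompact : compact M) (Mstable : forall g x, G g -> M x -> M (act g x))
  (a : {vspace 'rV[R]_(lg_dim UC)}) (aP : is_subalgebra_of p a) :
  let A := exp_group a in
  let mup_beta beta (x : set_type M) := bil B (mu_p Q p mu (val x)) beta in
  let mua (x : set_type M) := orth_proj B a (mu_p Q p mu (val x)) in
  forall (x0 : set_type M) (nu : probability (borel x0) R),
  (forall beta, beta \in a -> unique_local_max (mup_beta beta)) ->
  (forall beta, beta \in a ->
     \forall x \ae nu, top_unstable act (mup_beta beta) beta x) ->
  isotropy act A nu = [set 1%g] ->
  [set gradient_mean mua (push act g nu) | g in A]
    = interior_in a (mua @` [set: set_type M]).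
Proof.
move=> A mup_beta mua x0 nu _ nuW nuA.
have [ap aB] := aP.
have pu : (p <= imul u)%VS by apply/subvP => v /(compat_p GP)[].
have au : (a <= imul u)%VS := subv_trans ap pu.
have a0 v w : v \in a -> w \in a -> bracket v w = 0.
  exact: (subalgebra_bracket0 UCcx au aB).
have Bpos v : v \in a -> v != 0 -> 0 < bil B v v.
  by move=> /(subvP au) vu; exact (form_pos BP vu).
pose E := basis_mx a; pose r := \dim a.
have Ea (y : 'rV[R]_r) : y *m E \in a by exact: mul_basis_mx_in.
pose ex (y : 'rV[R]_r) : UC := lg_exp (y *m E).
have exG y x : M x -> M (act (ex y) x).
  move=> Mx; apply: Mstable => //.
  have [/(_ 1) + _] := (compat_p GP (y *m E)).1 (subvP ap _ (Ea y)).
  by rewrite scale1r.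
have exD y z : ex (y + z) = (ex y * ex z)%g.
  by rewrite /ex mulmxDl lg_expD // a0.
have ex0 : ex 0 = 1%g by rewrite /ex mul0mx lg_exp0.
have exC : continuous ex by exact: lg_exp_continuous_on.
(* The entries are the pairings of [mu_p] with the basis of [a], not the coordinates of its
   projection. With this choice the plain dot product with [y] is the component along [y *m E],
   although the basis need not be orthonormal. *)
pose mz z : 'rV[R]_r := mu_p Q p mu z *m (B *m E^T).
have mzC : continuous mz.
  exact (continuousT_comp (mu_p_continuous QP pu muP) (@linear_rV_continuous _ _ _ (mulmxr (B *m E^T)))).
have mz_dot z y : dot (mz z) y = bil B (mu_p Q p mu z) (y *m E).
  by rewrite dot_mulmxE /mz /bil trmx_mul !mulmxA.
pose m (x : borel x0) : 'rV[R]_r := mz (val (x : set_type M)).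
pose tau (y : 'rV[R]_r) (x : borel x0) : borel x0 := act_on act (ex y) (x : set_type M).
have val_tau y x : val (tau y x : set_type M) = act (ex y) (val (x : set_type M)).
  exact (val_act_on x (exG y)).
have actC y : continuous (act (ex y)).
  move=> z.
  have cg : continuous (fun _ : Z => ex y) by move=> ?; exact: cvg_cst.
  have ci : continuous (fun z : Z => z) by move=> ?; exact: cvg_id.
  exact (curve_act_continuous actP cg ci (x := z)).
have fD y c z : atlas c -> dom c z ->
    differentiable ((fun z => bil B (mu_p Q p mu z) (y *m E)) \o param c) (coord c z).
  move=> Ac cz; exact (mu_p_bil_differentiable B QP pu muP (y *m E) Ac cz).
have fC (y : 'rV[R]_r) : continuous (fun z => bil B (mu_p Q p mu z) (y *m E)).
  have -> : (fun z => bil B (mu_p Q p mu z) (y *m E)) = (fun z => dot (mz z) y).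
    by apply/funext => z; rewrite mz_dot.
  exact (dot_continuous mzC (@cst_continuous _ _ y)).
have fG y : is_gradient act omega (fun z => bil B (mu_p Q p mu z) (y *m E)) (y *m E).
  by apply: mupP; exact: subvP ap _ (Ea y).
have flow1 y z : act (ex y) z = flow act (y *m E) z 1 by rewrite /flow scale1r.
have main := @range_mean_interior R _ (borel x0) nu r m tau.
have [xm xmP] := exists_max (f := fun z => `|mz z|) (continuousT_comp mzC (@norm_continuous _ _)) x0 Mcompact.
have mL (x : borel x0) : `|m x| <= `|mz (val xm)| by exact: xmP.
have mm y : measurable_coords (fun x => m (tau y x)).
  move=> i.
  have -> : (fun x : borel x0 => m (tau y x) 0 i) = (fun x : set_type M => mz (act (ex y) (val x)) 0 i).
    by apply/funext => x; rewrite /m val_tau.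
  apply: continuous_measurable_borel.
  apply: (comp_set_val_continuous (f := fun z => mz (act (ex y) z) 0 i)).
  move=> z; exact (continuous_coord (continuousT_comp (actC y) mzC (x := z))).
have {}main := main _ mL mm.
have cm (x : borel x0) : continuous (fun y => m (tau y x)).
  have -> : (fun y => m (tau y x)) = (fun y => mz (act (ex y) (val (x : set_type M)))).
    by apply/funext => y; rewrite /m val_tau.
  have cc : continuous (fun _ : 'rV[R]_r => val (x : set_type M)).
    by move=> y; exact (@cst_continuous 'rV[R]_r Z (val (x : set_type M)) y).
  exact (continuousT_comp (curve_act_continuous actP exC cc) mzC).
have tau0 x : tau 0 x = x.
  by apply: val_inj; rewrite val_tau ex0 (act1 actP).
have tauD y z x : tau (y + z) x = tau y (tau z x).
  by apply: val_inj; rewrite !val_tau exD (actM actP).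
have tau_mono y x : dot (m x) y <= dot (m (tau y x)) y.
  rewrite !mz_dot val_tau flow1 -{1}(flow0 actP (y *m E) (val (x : set_type M))).
  exact: (flow_nondecreasing actP Zkahler (fD y) (fG y)).
have tau_strict y x : dot (m (tau y x)) y = dot (m x) y -> tau y x = x.
  rewrite !mz_dot val_tau flow1 => h; apply: val_inj; rewrite val_tau flow1.
  exact: (flow_strict actP Zkahler (fD y) (fG y)).
have tau_asym b : \forall x \ae nu, forall x' e, 0 < e ->
    \forall s \near +oo, dot (m x') b - e <= dot (m (tau (s *: b) x)) b.
  have [N [mN N0 sN]] := nuW (b *m E) (Ea b); exists N; split => // x nx.
  apply: sN => xt; apply: nx => x' e e0.
  have := top_unstable_limit (fC b) (fD b) x' Mcompact e0 xt.
  by apply: filterS => s; rewrite !mz_dot /tau /ex -scalemxAl.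
have tau_free y : (\forall x \ae nu, tau y x = x) -> y = 0.
  move=> [N [mN N0 fixN]].
  (* Off the null set [N] every point is fixed, so a set and its preimage under [tau y] coincide
     once [N] is adjoined to both. *)
  have : isotropy act A nu (ex y).
    split; first by exists (y *m E) => //=; exact: Ea.
    move=> S mS; rewrite /push /pushforward.
    have mtS : measurable (tau y @^-1` S).
      rewrite -[_ @^-1` _]setTI.
      by apply: (@continuous_borel_borel _ x0 (act_on act (ex y))) => //; exact: act_on_continuous (exG y).
    rewrite -(measureU0 mtS mN N0) -(measureU0 mS mN N0); congr (nu _).
    apply/seteqP; split => x [Sx|Nx]; [|by right| |by right];
      (have [Nx|nNx] := pselect (N x); [by right|left]);
      have tx : tau y x = x by (apply: contrapT => h; apply: nNx; exact: fixN).
      by rewrite -tx.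
    by rewrite /preimage /= tx.
  rewrite nuA => ey1.
  (* The pairs (1, 0) and (1, y E) are two Cartan decompositions of the identity, so y E = 0 by
     uniqueness. *)
  have [w [_ wU]] := cx_cartan UCcx 1%g.
  have [U1 _ _] := cx_subgroup UCcx.
  have w1 : w = (1%g, 0) by apply: wU; split => //=; rewrite ?mem0v ?lg_exp0 ?mulg1.
  have w2 : w = (1%g, y *m E).
    apply: wU; split => //=; first exact: subvP au _ (Ea y).
    by rewrite mul1g [lg_exp _]ey1.
  have /mul_basis_mx_eq0 // : y *m basis_mx a = 0.
  by have := w1; rewrite w2 => -[].
have {}main := main cm tau0 tauD tau_mono tau_strict tau_asym tau_free.
(* [H] turns pairings with the basis back into the vector of [a]: it is inverse to [B *m E^T] on
   [a], and it sends [m x] to [mua x]. *)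
pose H := invmx (gram B a) *m E.
have mHE v : v \in a -> (v *m (B *m E^T)) *m H = v.
  move=> /mem_basis_mx[c ->]; rewrite /H !mulmxA.
  rewrite -(mulmxA c) -(mulmxA c) -/E -/(gram B a) mulmxK //.
  exact: gram_unit.
have HmE (c : 'rV[R]_r) : (c *m H) *m (B *m E^T) = c.
  rewrite /H !mulmxA -(mulmxA _ E) -(mulmxA _ _ E^T) -/(gram B a) mulmxKV //.
  exact: gram_unit.
have muaE x : mua x = m x *m H.
  by rewrite /mua orth_projE // /m /mz /H /proj_mx !mulmxA.
have Ha c : c *m H \in a by rewrite /H mulmxA; exact: mul_basis_mx_in.
have mzHC : continuous (fun z => mz z *m H).
  exact (continuousT_comp mzC (@linear_rV_continuous _ _ _ (mulmxr H))).
have gmE y : gradient_mean mua (push act (ex y) nu) = mean nu (fun x => m (tau y x)) *m H.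
  have mtau : measurable_fun setT (tau y).
    exact (continuous_borel_borel (act_on_continuous actP (exG y))).
  have muam : mua = (fun x : set_type M => m x *m H) by apply/funext => x; exact: muaE.
  have mmu : measurable_coords (mua : borel x0 -> _).
    move=> j; apply: continuous_measurable_borel; rewrite muam.
    apply: (comp_set_val_continuous (f := fun z => (mz z *m H) 0 j)) => z.
    exact (continuous_coord (mzHC z)).
  have [ym ymP] := exists_max (f := fun z => `|mz z *m H|) (continuousT_comp mzHC (@norm_continuous _ _)) x0 Mcompact.
  have muL (x : borel x0) : `|mua x| <= `|mz (val ym) *m H| by rewrite muaE; exact: ymP.
  rewrite /push (gradient_mean_pushforward nu mtau mmu muL).
  apply/rowP => j; rewrite -(mean_mulmx nu H j (mm y) (fun x => mL (tau y x))) mxE.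
  by congr fine; apply: eq_integral => x _; rewrite muaE.
(* The mutually inverse continuous linear maps given by [H] and [B *m E^T] transport [main] from row
   vectors to [a]. The interior is relative to [a], so neighbourhoods in the ambient space are
   pulled back and only their points in [a] are considered. *)
apply/seteqP; split => [_ [g [v va <-] <-]|v [va vP]].
  have [c vE] := mem_basis_mx va.
  rewrite vE -/E -/(ex c) gmE.
  have : [set mean nu (fun x => m (tau y x)) | y in [set: 'rV[R]_r]] (mean nu (fun x => m (tau c x))).
    by exists c.
  rewrite main /= => mP; split; first exact: Ha.
  have cphi : continuous (fun w : 'rV[R]_(lg_dim UC) => w *m (B *m E^T)).
    exact (@linear_rV_continuous _ _ _ (mulmxr (B *m E^T))).
  have h : nbhs (mean nu (fun x => m (tau c x)) *m H)
      [set w | exists x, m x = w *m (B *m E^T)].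
    by apply: (@cphi _ [set w | exists x, m x = w]); rewrite HmE.
  apply: filterS h => w [x mx] wa.
  by exists x => //; rewrite muaE mx mHE.
pose c := v *m (B *m E^T).
have : [set w | \forall w \near w, exists x, m x = w] c.
  have cpsi : continuous (fun w : 'rV[R]_r => w *m H).
    exact (@linear_rV_continuous _ _ _ (mulmxr H)).
  have h : nbhs c [set w | w *m H \in a -> range mua (w *m H)].
    by apply: (@cpsi c [set w | w \in a -> range mua w]); rewrite /c mHE.
  apply: filterS h => w /= /(_ (Ha w)) [x _ xw].
  by exists x; rewrite -(HmE (m x)) -muaE xw HmE.
rewrite -main => -[y _ yc]; exists (ex y); first by exists (y *m E) => //=; exact: Ea.
by rewrite gmE yc /c mHE.
Qed.
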